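(* Let $M$ be a countable model of $\mathrm{ZFC}$, let $\mathcal{N}\in M$ be a structure (in the sense of $M$) in a finite language, and let $S\in M$ with $M\models S\subseteq\mathcal{N}$ (i.e. $S$ is a subset of the domain of $\mathcal{N}$) such that, from the perspective of $M$, $S$ is not definable in $\mathcal{N}$ with parameters. Then there are elementary extensions $M\prec M_1$ and $M\prec M_2$ such that $\mathcal{N}^{M_1}=\mathcal{N}^{M_2}$ (the interpretations of $\mathcal{N}$ in $M_1$ and $M_2$ have exactly the same elements, the same language, and the same interpretations of all function, relation and constant symbols), but $S^{M_1}\neq S^{M_2}$.
   Context: Models of set theory are arbitrary structures $\langle M,\in^M\rangle$, not necessarily well-founded. For an elementary extension $M\prec M'$ and an object $x\in M$, $x^{M'}$ denotes the object of $M'$ that is the image of $x$ (and, when viewed as a set or structure, the collection of elements that $M'$ thinks belong to it, with the relations $M'$ thinks it has). *)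

(* Defs.v *)
From mathcomp Require Import all_boot.
From mathcomp Require Import boolp classical_sets functions cardinality.

Set Implicit Arguments.
Unset Strict Implicit.
Unset Printing Implicit Defensive.

Local Open Scope classical_set_scope.

(* A structure for the language of set theory; the relation is arbitrary and
   in particular need not be well-founded. *)
Record model := Model { carrier :> Type; eps : carrier -> carrier -> Prop }.

Declare Scope model_scope.
Delimit Scope model_scope with model.
Notation "x ∈ y" := (eps x y) (at level 70) : model_scope.
Local Open Scope model_scope.

(* First-order formulas of the language {∈}, with variables named by natural
   numbers. *)
Inductive fml : Type :=
| FMem of nat & nat
| FEq of nat & nat
| FNot of fml
| FAnd of fml & fml
| FEx of nat & fml.

Definition upd (T : Type) (v : nat -> T) (i : nat) (a : T) : nat -> T :=
  fun k => if k == i then a else v k.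

Fixpoint sat (M : model) (v : nat -> M) (p : fml) : Prop :=
  match p with
  | FMem i j => v i ∈ v j
  | FEq i j => v i = v j
  | FNot q => ~ sat v q
  | FAnd q r => sat v q /\ sat v r
  | FEx i q => exists a : M, sat (upd v i a) q
  end.

Definition elementary (M M' : model) (j : M -> M') : Prop :=
  forall (p : fml) (v : nat -> M), sat v p <-> sat (j \o v) p.

(* Except for [ZFC], every predicate down to [definable] quantifies over [M]
   only: it spells out the satisfaction in [M] of a set-theoretic formula, so
   that natural numbers, finiteness, formulas and satisfaction are those of
   [M], and may be nonstandard. *)

Definition subset_in (M : model) (x y : M) : Prop :=
  forall z : M, z ∈ x -> z ∈ y.

Definition is_empty (M : model) (x : M) : Prop := forall z : M, ~ z ∈ x.

Definition is_upair (M : model) (p x y : M) : Prop :=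
  forall z : M, z ∈ p <-> z = x \/ z = y.

(* [p] is the Kuratowski pair {{x}, {x, y}}. *)
Definition is_pair (M : model) (p x y : M) : Prop :=
  exists a b : M, [/\ is_upair a x x, is_upair b x y & is_upair p a b].

Definition pair_in (M : model) (r x y : M) : Prop :=
  exists p : M, is_pair p x y /\ p ∈ r.

Definition is_succ (M : model) (s n : M) : Prop :=
  forall z : M, z ∈ s <-> z ∈ n \/ z = n.

Definition inductive_set (M : model) (w : M) : Prop :=
  (exists e : M, is_empty e /\ e ∈ w) /\
  (forall n : M, n ∈ w -> exists s : M, is_succ s n /\ s ∈ w).

Definition is_omega (M : model) (w : M) : Prop :=
  inductive_set w /\ forall z : M, inductive_set z -> subset_in w z.

Fixpoint is_numeral (M : model) (k : nat) (x : M) : Prop :=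
  match k with
  | 0 => is_empty x
  | k'.+1 => exists y : M, is_numeral k' y /\ is_succ x y
  end.

Definition is_function (M : model) (f a b : M) : Prop :=
  (forall p : M, p ∈ f -> exists x y : M, [/\ x ∈ a, y ∈ b & is_pair p x y]) /\
  (forall x : M, x ∈ a -> exists! y : M, pair_in f x y).

Definition is_bijection (M : model) (f a b : M) : Prop :=
  is_function f a b /\
  (forall y : M, y ∈ b -> exists! x : M, pair_in f x y).

Definition is_finite (M : model) (x : M) : Prop :=
  exists w n f : M, [/\ is_omega w, n ∈ w & is_bijection f n x].

(* Separation and Replacement range over all formulas [p] and all assignments
   [v] of parameters; the distinguished free variables are numbered 0 and 1. *)
Record ZFC (M : model) : Prop := {
  zfc_extensionality : forall x y : M, (forall z : M, z ∈ x <-> z ∈ y) -> x = y;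
  zfc_foundation : forall x : M, (exists y : M, y ∈ x) ->
    exists y : M, y ∈ x /\ ~ (exists z : M, z ∈ x /\ z ∈ y);
  zfc_pairing : forall x y : M, exists p : M, is_upair p x y;
  zfc_union : forall x : M, exists u : M,
    forall z : M, z ∈ u <-> exists y : M, z ∈ y /\ y ∈ x;
  zfc_powerset : forall x : M, exists u : M,
    forall z : M, z ∈ u <-> subset_in z x;
  zfc_infinity : exists w : M, inductive_set w;
  zfc_separation : forall (p : fml) (v : nat -> M) (a : M), exists b : M,
    forall x : M, x ∈ b <-> x ∈ a /\ sat (upd v 0 x) p;
  zfc_replacement : forall (p : fml) (v : nat -> M) (a : M),
    (forall x y z : M, x ∈ a -> sat (upd (upd v 0 x) 1 y) p ->
       sat (upd (upd v 0 x) 1 z) p -> y = z) ->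
    exists b : M, forall y : M,
      y ∈ b <-> exists x : M, x ∈ a /\ sat (upd (upd v 0 x) 1 y) p;
  zfc_choice : forall a : M,
    (forall x : M, x ∈ a -> exists y : M, y ∈ x) ->
    (forall x y z : M, x ∈ a -> y ∈ a -> z ∈ x -> z ∈ y -> x = y) ->
    exists c : M, forall x : M, x ∈ a -> exists! y : M, y ∈ x /\ y ∈ c
}.

(* An element [code] of [M] that [M] believes to be a first-order structure
   ⟨dom, ⟨rels, ⟨funs, ⟨ar, itp⟩⟩⟩⟩: [rels] and [funs] are the sets of relation
   and function symbols, [ar] and [itp] the functions giving the arity and the
   interpretation of each symbol. Constant symbols are the function symbols of
   arity 0. The fields other than [code] are determined by [code]. *)
Record structure (M : model) := Structure {
  code : M; dom : M; rels : M; funs : M; ar : M; itp : M;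
  code_tuple : exists p q r : M,
    [/\ is_pair code dom p, is_pair p rels q, is_pair q funs r
      & is_pair r ar itp];
  dom_nonempty : exists x : M, x ∈ dom;
  symbols_disjoint : forall s : M, ~ (s ∈ rels /\ s ∈ funs);
  ar_function : exists w L : M, [/\ is_omega w,
    forall s : M, s ∈ L <-> s ∈ rels \/ s ∈ funs & is_function ar L w];
  itp_function : exists L B : M,
    (forall s : M, s ∈ L <-> s ∈ rels \/ s ∈ funs) /\ is_function itp L B;
  itp_rel : forall s n R t : M, s ∈ rels -> pair_in ar s n ->
    pair_in itp s R -> t ∈ R -> is_function t n dom;
  itp_fun : forall s n f : M, s ∈ funs -> pair_in ar s n -> pair_in itp s f ->
    exists P : M, (forall t : M, t ∈ P <-> is_function t n dom) /\
                  is_function f P dom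
}.

Definition finite_language (M : model) (N : structure M) : Prop :=
  is_finite (rels N) /\ is_finite (funs N).

(* [c] is the pair ⟨k, x⟩, respectively ⟨k, ⟨x, y⟩⟩; the tag [k] tells apart
   the constructors of terms and formulas. *)
Definition tagged (M : model) (k : nat) (x c : M) : Prop :=
  exists n : M, is_numeral k n /\ is_pair c n x.

Definition tagged2 (M : model) (k : nat) (x y c : M) : Prop :=
  exists p : M, is_pair p x y /\ tagged k p c.

(* Terms: ⟨0, i⟩ is the variable v_i, and ⟨1, ⟨f, u⟩⟩ is the application of
   the function symbol f to the tuple of terms u. *)
Definition term_closed (M : model) (N : structure M) (w X : M) : Prop :=
  (forall i c : M, i ∈ w -> tagged 0 i c -> c ∈ X) /\
  (forall f n u c : M, f ∈ funs N -> pair_in (ar N) f n ->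
     is_function u n X -> tagged2 1 f u c -> c ∈ X).

Definition is_term_set (M : model) (N : structure M) (w T : M) : Prop :=
  term_closed N w T /\ forall X : M, term_closed N w X -> subset_in T X.

(* Formulas: ⟨2, ⟨t, t'⟩⟩ is t = t', ⟨3, ⟨r, u⟩⟩ is r(u), ⟨4, a⟩ is ¬a,
   ⟨5, ⟨a, b⟩⟩ is a ∧ b and ⟨6, ⟨i, a⟩⟩ is ∃ v_i, a. *)
Definition form_closed (M : model) (N : structure M) (w T X : M) : Prop :=
  [/\ forall t t' c : M, t ∈ T -> t' ∈ T -> tagged2 2 t t' c -> c ∈ X,
      forall r n u c : M, r ∈ rels N -> pair_in (ar N) r n ->
        is_function u n T -> tagged2 3 r u c -> c ∈ X,
      forall a c : M, a ∈ X -> tagged 4 a c -> c ∈ X,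
      forall a b c : M, a ∈ X -> b ∈ X -> tagged2 5 a b c -> c ∈ X
    & forall i a c : M, i ∈ w -> a ∈ X -> tagged2 6 i a c -> c ∈ X].

Definition is_form_set (M : model) (N : structure M) (w T F : M) : Prop :=
  form_closed N w T F /\ forall X : M, form_closed N w T X -> subset_in F X.

(* [s] assigns an element of the structure to every variable v_i, i ∈ ω. *)
Definition is_assignment (M : model) (N : structure M) (w s : M) : Prop :=
  is_function s w (dom N).

Definition is_update (M : model) (N : structure M) (w s i d s' : M) : Prop :=
  [/\ is_assignment N w s', pair_in s' i d
    & forall k a : M, k ∈ w -> k <> i -> pair_in s' k a <-> pair_in s k a].

(* ⟨⟨t, s⟩, d⟩ ∈ V *)
Definition value (M : model) (V t s d : M) : Prop :=
  exists p : M, is_pair p t s /\ pair_in V p d.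

(* [y] is the [n]-tuple of the values under [s] of the [n]-tuple of terms [u]. *)
Definition tuple_value (M : model) (N : structure M) (V n u s y : M) : Prop :=
  is_function y n (dom N) /\
  forall k t a : M, pair_in u k t -> pair_in y k a -> value V t s a.

Definition is_evaluation (M : model) (N : structure M) (w T V : M) : Prop :=
  (forall i c s d : M, i ∈ w -> tagged 0 i c -> is_assignment N w s ->
     value V c s d <-> pair_in s i d) /\
  (forall f n u c s d : M, f ∈ funs N -> pair_in (ar N) f n ->
     is_function u n T -> tagged2 1 f u c -> is_assignment N w s ->
     value V c s d <->
     exists y g : M, [/\ tuple_value N V n u s y, pair_in (itp N) f g
                       & pair_in g y d]).

(* Tarski's clauses: for formulas [c] and assignments [s],
   ⟨c, s⟩ ∈ Tr iff [c] holds in the structure under [s]. *)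
Definition is_satisfaction (M : model) (N : structure M) (w T F V Tr : M)
    : Prop :=
  forall s : M, is_assignment N w s ->
  [/\ forall t t' c : M, t ∈ T -> t' ∈ T -> tagged2 2 t t' c ->
        pair_in Tr c s <-> exists d : M, value V t s d /\ value V t' s d,
      forall r n u c : M, r ∈ rels N -> pair_in (ar N) r n ->
        is_function u n T -> tagged2 3 r u c ->
        pair_in Tr c s <->
        exists y R : M, [/\ tuple_value N V n u s y, pair_in (itp N) r R
                          & y ∈ R],
      forall a c : M, a ∈ F -> tagged 4 a c ->
        pair_in Tr c s <-> ~ pair_in Tr a s,
      forall a b c : M, a ∈ F -> b ∈ F -> tagged2 5 a b c ->
        pair_in Tr c s <-> pair_in Tr a s /\ pair_in Tr b s
    & forall i a c : M, i ∈ w -> a ∈ F -> tagged2 6 i a c ->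
        pair_in Tr c s <->
        exists d s' : M, [/\ d ∈ dom N, is_update N w s i d s'
                           & pair_in Tr a s']].

(* In [M], the set [S] is {x ∈ dom N | N ⊨ a[s(v_0 := x)]} for some formula [a]
   and assignment [s]; the parameters are the values under [s] of the free
   variables of [a] other than v_0. *)
Definition definable (M : model) (N : structure M) (S : M) : Prop :=
  exists w T F V Tr : M,
    [/\ is_omega w, is_term_set N w T, is_form_set N w T F,
        is_evaluation N w T V & is_satisfaction N w T F V Tr] /\
  exists z a s : M, [/\ is_empty z, a ∈ F, is_assignment N w s &
    forall x : M, x ∈ dom N ->
      x ∈ S <-> exists s' : M, is_update N w s z x s' /\ pair_in Tr a s'].

(* An elementary extension of [M]. In order that objects of different
   extensions can be compared, [M] and its extensions are placed, by the
   injections [i] and [incl], inside a common set [U], and [embE] says that [M]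
   is then literally a subset of the extension. *)
Record elementary_extension (M : model) (U : Type) (i : M -> U) := ElemExt {
  ext :> model;
  incl : ext -> U;
  incl_inj : injective incl;
  emb : M -> ext;
  embE : forall x : M, incl (emb x) = i x;
  emb_elementary : elementary emb
}.

(* The set x^{M'} of the elements that M' thinks belong to x. *)
Definition elements (M : model) (U : Type) (i : M -> U)
    (M' : elementary_extension i) (x : M) : set U :=
  [set incl y | y in [set y : M' | y ∈ emb M' x]].

(* The actual set of pairs coded by an element [r] of M'. *)
Definition graph (M : model) (U : Type) (i : M -> U)
    (M' : elementary_extension i) (r : M') : set (U * U) :=
  [set q | exists x y : M', pair_in r x y /\ q = (incl x, incl y)].

(* A first-order structure with symbols and elements in [U]. Tuples are given
   by their graphs: sets of pairs (position, entry). *)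
Record ext_structure (U : Type) := ExtStructure {
  xdom : set U;
  xrels : set U;
  xfuns : set U;
  xar : set (U * U);
  xitp_rel : U -> set (set (U * U));
  xitp_fun : U -> set (set (U * U) * U)
}.

(* N^{M'} *)
Definition interpretation (M : model) (U : Type) (i : M -> U)
    (M' : elementary_extension i) (N : structure M) : ext_structure U :=
  {| xdom := elements M' (dom N);
     xrels := elements M' (rels N);
     xfuns := elements M' (funs N);
     xar := graph (emb M' (ar N));
     xitp_rel := fun u => [set g | exists s R t : M',
       [/\ incl s = u, s ∈ emb M' (rels N), pair_in (emb M' (itp N)) s R,
           t ∈ R & g = graph t]];
     xitp_fun := fun u => [set gv | exists s f t y : M',
       [/\ incl s = u, s ∈ emb M' (funs N), pair_in (emb M' (itp N)) s f,
           pair_in f t y & gv = (graph t, incl y)]] |}.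

(* Main.v *)
Require Import Defs.
From mathcomp Require Import all_boot.
From mathcomp Require Import boolp classical_sets functions cardinality filter.
Import Defs.

(* In M, consider back-and-forth games between assignments into N, where a move
   is a tuple of N longer than every arity (lengths, like the number of symbols,
   may be nonstandard). Since the language is finite in M, for each standard
   number q of rounds the q-equivalence relation has, in M, finitely many
   classes, all definable in N. Hence for every q and every M-finite set X there
   are a in S and b outside S that are q-equivalent over X: otherwise S would be
   a finite union of classes, hence definable with parameters.

   In an ultrapower of M over the natural numbers, the games with more and more
   rounds over larger and larger X become a game of infinitely many rounds over
   all the elements of M. As M is countable, so is its closure
   M1, inside the ultrapower, under Skolem functions and under the answers in the
   game. M1 is an elementary extension of M, and a play that exhausts its tuples
   yields a permutation of N^M1 that respects N, fixes the elements of M, the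
   symbols and the indices, and moves some a in S^M1 out of S^M1. Renaming the
   elements of M1 along this permutation gives M2. *)

Set Implicit Arguments.
Unset Strict Implicit.
Unset Printing Implicit Defensive.

Local Open Scope classical_set_scope.
Local Open Scope model_scope.

(** * Definability in families of models *)

(** Whole tuples are played, not single elements, because arities may be nonstandard: a tuple of an
    extension can have infinitely many entries, which no finite number of single moves would match,
    whereas the tuple is one object of the model and costs one round. The entry beyond every arity
    holds the value of a function, so that functions are treated like relations. The number of
    rounds is standard because the finiteness of the number of classes is proved by an induction
    outside $M$; infinitely many rounds appear only in the ultrapower, where a play has one round
    for each natural number. A full ultrapower could have uncountably many tuples, too many for such
    a play, hence the countable closure. Symbols and indices are fixed from the start because they
    may also be elements of the structure, and moving them would change arities and the graphs of
    tuples. The permutation lives outside the extension and need not respect its membership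
    relation: it acts only on the names of the elements. *)

Definition interleave (T : Type) (v e : nat -> T) (k : nat) : T :=
  if odd k then e k./2 else v k./2.

Lemma interleave_even (T : Type) (v e : nat -> T) (k : nat) :
  interleave v e k.*2 = v k.
Proof. by rewrite /interleave odd_double doubleK. Qed.

Lemma interleave_odd (T : Type) (v e : nat -> T) (k : nat) :
  interleave v e k.*2.+1 = e k.
Proof. by rewrite /interleave /= odd_double /= uphalf_double. Qed.

Lemma interleaveP (T : Type) (v e w : nat -> T) :
  (forall k, w k.*2 = v k) -> (forall k, w k.*2.+1 = e k) ->
  w = interleave v e.
Proof.
move=> wv we; apply/funext => k; rewrite -[k]odd_double_half /interleave.
by case: (odd k); rewrite ?add0n ?add1n /= ?odd_double /= ?uphalf_double ?doubleK.
Qed.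

Lemma upd_eq (T : Type) (v : nat -> T) (i : nat) (a : T) : upd v i a i = a.
Proof. by rewrite /upd eqxx. Qed.

Lemma upd_interleave (T : Type) (v e : nat -> T) (n : nat) (a : T) :
  upd (interleave v e) n.*2 a = interleave (upd v n a) e.
Proof.
apply: interleaveP => k; rewrite /upd.
- rewrite interleave_even; congr (if _ then _ else _).
  by rewrite -!muln2 eqn_pmul2r.
- rewrite interleave_odd; case: eqP => // /(congr1 odd).
  by rewrite /= !odd_double.
Qed.

Fixpoint rename (r : nat -> nat) (p : fml) : fml :=
  match p with
  | FMem i j => FMem (r i) (r j)
  | FEq i j => FEq (r i) (r j)
  | FNot q => FNot (rename r q)
  | FAnd q q' => FAnd (rename r q) (rename r q')
  | FEx i q => FEx (r i) (rename r q)
  end.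

Lemma sat_rename (M : model) (r : nat -> nat) (p : fml) (v : nat -> M) :
  injective r -> sat v (rename r p) <-> sat (v \o r) p.
Proof.
move=> r_inj; elim: p v => //= [q IH|q IH q' IH'|i q IH] v.
- by rewrite IH.
- by rewrite IH IH'.
- have E a : upd v (r i) a \o r = upd (v \o r) i a.
    by apply/funext => k; rewrite /upd /= (inj_eq r_inj).
  by split=> -[a Ha]; exists a; [rewrite -E; apply/IH|apply/IH; rewrite E].
Qed.

(* Definability is uniform over a family [F] of models: one formula, with one
   family of parameters per constant, defines [P j] in every [F j]. With
   [J = unit] this is definability with parameters; taking for [F] the factors
   of an ultrapower together with the ultrapower, and for [K] the families made
   of an element of the product and its class, gives the predicates to which
   Łoś's theorem applies. *)
Section Definability.
Variables (J : Type) (F : J -> model) (K : (forall j, F j) -> Prop).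

(** In [interleave], even places carry the arguments and odd places the parameters. Both supplies
    are infinite, so predicates can be combined without clashes of variables. *)
Definition def_pred (P : forall j, (nat -> F j) -> Prop) : Prop :=
  exists (p : fml) (e : forall j, nat -> F j),
    (forall k, K (fun j => e j k)) /\
    forall j v, sat (interleave v (e j)) p <-> P j v.

Definition def_term (x : forall j, (nat -> F j) -> F j) : Prop :=
  (exists k, forall j v, x j v = v k) \/
  (exists c : forall j, F j, K c /\ forall j v, x j v = c j).

Variables (pt : forall j, F j) (ptK : K pt).

(** The parameter slot [m] is reserved for the term. If the term is a variable, the slot is filled
    with the dummy [pt]. *)
Lemma def_termP x m : def_term x -> exists i (c : forall j, F j), K c /\
  forall j (v e : nat -> F j), e m = c j -> interleave v e i = x j v.
Proof.
move=> [[k xk]|[c [Kc xc]]].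
- by exists k.*2, pt; split=> // j v e _; rewrite interleave_even xk.
- by exists m.*2.+1, c; split=> // j v e em; rewrite interleave_odd xc.
Qed.

Lemma def_atom (atom : nat -> nat -> fml) (R : forall j, F j -> F j -> Prop) x y :
  (forall j (v : nat -> F j) i k, sat v (atom i k) <-> R j (v i) (v k)) ->
  def_term x -> def_term y -> def_pred (fun j v => R j (x j v) (y j v)).
Proof.
move=> atomP /(def_termP 0)[i [c [Kc ic]]] /(def_termP 1)[k [d [Kd kd]]].
exists (atom i k), (fun j n => if n == 0 then c j else d j); split=> [[|n] //|j v].
by rewrite atomP ic // kd.
Qed.

Lemma def_mem x y : def_term x -> def_term y ->
  def_pred (fun j v => x j v ∈ y j v).
Proof. exact: (def_atom (atom := FMem) (R := fun j => @eps (F j))). Qed.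

Lemma def_eq x y : def_term x -> def_term y ->
  def_pred (fun j v => x j v = y j v).
Proof. exact: (def_atom (atom := FEq) (R := fun j => @eq (F j))). Qed.

Lemma def_not P : def_pred P -> def_pred (fun j v => ~ P j v).
Proof.
by move=> [p [e [Ke pe]]]; exists (FNot p), e; split=> // j v /=; rewrite pe.
Qed.

Lemma def_and P Q : def_pred P -> def_pred Q ->
  def_pred (fun j v => P j v /\ Q j v).
Proof.
move=> [p [e [Ke pe]]] [q [d [Kd qd]]].
(* Parameter [i] moves to parameter [2i + b], which separates the parameters of [p] from those of
   [q]; arguments stay in place. *)
pose r b k := if odd k then (k./2.*2 + b).*2.+1 else k.
have r_half (b : bool) k : r b k = if odd k then (k./2.*2 + b).*2.+1 else k by [].
have r_inj (b : bool) : injective (r b).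
  move=> k l; rewrite !r_half.
  case: ifP => ok; case: ifP => ol.
  - move=> [] /(congr1 half); rewrite !doubleK => /addIn /(congr1 half).
    rewrite !doubleK => kl.
    by rewrite -(odd_double_half k) -(odd_double_half l) ok ol kl.
  - by move=> E; move: ol; rewrite -E /= odd_double.
  - by move=> E; move: ok; rewrite E /= odd_double.
  - by [].
exists (FAnd (rename (r false) p) (rename (r true) q)),
  (fun j => interleave (e j) (d j)); split=> [k|j v /=].
  by rewrite /interleave; case: (odd k).
have -> : sat (interleave v (interleave (e j) (d j))) (rename (r false) p)
    <-> P j v.
  rewrite (sat_rename _ _ (r_inj false)) -pe; suff -> :
    interleave v (interleave (e j) (d j)) \o r false = interleave v (e j) by [].
  apply: interleaveP => k /=; rewrite /r /= odd_double ?interleave_even //=.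
  by rewrite uphalf_double addn0 interleave_odd interleave_even.
suff -> : sat (interleave v (interleave (e j) (d j))) (rename (r true) q)
    <-> Q j v by [].
rewrite (sat_rename _ _ (r_inj true)) -qd; suff -> :
  interleave v (interleave (e j) (d j)) \o r true = interleave v (d j) by [].
apply: interleaveP => k /=; rewrite /r /= odd_double ?interleave_even //=.
by rewrite uphalf_double addn1 !interleave_odd.
Qed.

(* [n] has to be chosen fresh: the second hypothesis then holds by
   computation. *)
Lemma def_ex n (B : forall j, (nat -> F j) -> F j -> Prop) :
  def_pred (fun j v => B j v (v n)) ->
  (forall j v x, B j (upd v n x) (upd v n x n) <-> B j v x) ->
  def_pred (fun j v => exists x, B j v x).
Proof.
move=> [p [e [Ke pe]]] Bn; exists (FEx n.*2 p), e; split=> // j v /=.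
split=> -[x Hx]; exists x; move: Hx; rewrite upd_interleave.
- by rewrite pe Bn.
- by rewrite pe Bn.
Qed.

Lemma def_ext P Q : (forall j v, P j v <-> Q j v) -> def_pred P -> def_pred Q.
Proof.
by move=> PQ [p [e [Ke pe]]]; exists p, e; split=> // j v; rewrite -PQ.
Qed.

Lemma def_or P Q : def_pred P -> def_pred Q ->
  def_pred (fun j v => P j v \/ Q j v).
Proof.
move=> dP dQ.
have := def_not (def_and (def_not dP) (def_not dQ)).
by apply: def_ext => j v; rewrite not_andP !notK.
Qed.

Lemma def_imp P Q : def_pred P -> def_pred Q ->
  def_pred (fun j v => P j v -> Q j v).
Proof.
move=> dP dQ; have := def_or (def_not dP) dQ.
by apply: def_ext => j v; rewrite implyE.
Qed.

Lemma def_iff P Q : def_pred P -> def_pred Q ->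
  def_pred (fun j v => P j v <-> Q j v).
Proof. by move=> dP dQ; apply: def_and; apply: def_imp. Qed.

Lemma def_all n (B : forall j, (nat -> F j) -> F j -> Prop) :
  def_pred (fun j v => B j v (v n)) ->
  (forall j v x, B j (upd v n x) (upd v n x n) <-> B j v x) ->
  def_pred (fun j v => forall x, B j v x).
Proof.
move=> dB Bn.
have dN : def_pred (fun j v => exists x, ~ B j v x).
  apply: (def_ex (n := n) (B := fun j v x => ~ B j v x)) (def_not dB) _.
  by move=> j v x; rewrite Bn.
apply: def_ext (def_not dN) => j v.
by rewrite -forallNE; split=> H x; [apply: contrapT|have := H x; tauto].
Qed.

Lemma def_and3 P Q R : def_pred P -> def_pred Q -> def_pred R ->
  def_pred (fun j v => [/\ P j v, Q j v & R j v]).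
Proof.
move=> dP dQ dR; have := def_and dP (def_and dQ dR).
by apply: def_ext => j v; split=> [[? []]|[]].
Qed.

Lemma def_and4 P Q R T : def_pred P -> def_pred Q -> def_pred R ->
  def_pred T -> def_pred (fun j v => [/\ P j v, Q j v, R j v & T j v]).
Proof.
move=> dP dQ dR dT; have := def_and dP (def_and3 dQ dR dT).
by apply: def_ext => j v; split=> [[? []]|[]].
Qed.

Lemma def_and5 P Q R T U : def_pred P -> def_pred Q -> def_pred R ->
  def_pred T -> def_pred U ->
  def_pred (fun j v => [/\ P j v, Q j v, R j v, T j v & U j v]).
Proof.
move=> dP dQ dR dT dU; have := def_and dP (def_and4 dQ dR dT dU).
by apply: def_ext => j v; split=> [[? []]|[]].
Qed.

End Definability.

Definition definable1 (M : model) (P : M -> Prop) : Prop :=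
  def_pred (F := fun _ : unit => M) (fun _ => True) (fun _ v => P (v 0)).

Definition definable2 (M : model) (R : M -> M -> Prop) : Prop :=
  def_pred (F := fun _ : unit => M) (fun _ => True) (fun _ v => R (v 0) (v 1)).

Create HintDb admissible.

Ltac prove_def_term :=
  first [ left; eexists; intros; reflexivity
        | right; eexists; split; [ | intros; reflexivity ];
          solve [ exact I | eauto with admissible ] ].

(* [ptK] provides a point of every model and [n] is the next fresh variable. *)
Ltac prove_def_from ptK n :=
  cbv beta;
  lazymatch goal with
  | |- def_pred _ (fun j v => eps _ _) =>
      apply (def_mem ptK); prove_def_term
  | |- def_pred _ (fun j v => _ = _) => apply (def_eq ptK); prove_def_term
  | |- def_pred _ (fun j v => ~ _) => apply def_not; prove_def_from ptK n
  | |- def_pred _ (fun j v => _ /\ _) =>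
      apply def_and; prove_def_from ptK n
  | |- def_pred _ (fun j v => _ \/ _) =>
      apply def_or; prove_def_from ptK n
  | |- def_pred _ (fun j v => _ <-> _) =>
      apply def_iff; prove_def_from ptK n
  | |- def_pred _ (fun j v => and3 _ _ _) =>
      apply def_and3; prove_def_from ptK n
  | |- def_pred _ (fun j v => and4 _ _ _ _) =>
      apply def_and4; prove_def_from ptK n
  | |- def_pred _ (fun j v => and5 _ _ _ _ _) =>
      apply def_and5; prove_def_from ptK n
  | |- def_pred _ (fun j v => ex _) =>
      apply (@def_ex _ _ _ n);
      [ prove_def_from ptK (S n) | intros; reflexivity ]
  | |- def_pred _ (fun j v => forall x, _) =>
      first [ apply def_imp; prove_def_from ptK n
            | apply (@def_all _ _ _ n);
              [ prove_def_from ptK (S n) | intros; reflexivity ] ]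
  | |- _ => progress (autounfold with definability); prove_def_from ptK n
  end.

Ltac prove_def ptK :=
  unfold definable1, definable2;
  (* Only the variables 0 and 1 are free, so every number from 4 on is fresh. *)
  prove_def_from ptK 4.

#[global] Hint Unfold subset_in is_empty is_upair is_pair pair_in is_succ
  inductive_set is_omega is_function is_bijection is_finite tagged2
  tagged is_numeral unique is_assignment is_update value tuple_value : definability.

(** * Set theory inside a model of ZFC *)

Record zfc_model := ZFCModel { zfc_carrier :> model; zfcP : ZFC zfc_carrier }.

Section Sets.
Variable M : zfc_model.
Implicit Types x y z a b c f r s p : M.

Definition point : M := projT1 (cid (zfc_infinity (zfcP M))).

Lemma point_admissible : (fun _ : unit -> M => True) (fun _ => point).
Proof. by []. Qed.

(** External choice turns the set operations into functions on [M]. The definability tactics accept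
    only variables and constants as terms, so predicates used in Separation or in an induction are
    written with relations such as [is_pair] or [is_succ] instead. *)
Definition pick (P : M -> Prop) : M :=
  if pselect (exists x, P x) is left e then projT1 (cid e) else point.

Lemma pickP (P : M -> Prop) : (exists x, P x) -> P (pick P).
Proof. by rewrite /pick; case: pselect => // e _; case: (cid e). Qed.

Lemma set_ext x y : (forall z, z ∈ x <-> z ∈ y) -> x = y.
Proof. exact: (zfc_extensionality (zfcP M)). Qed.

Lemma separation (P : M -> Prop) a : definable1 P ->
  exists b, forall x, x ∈ b <-> x ∈ a /\ P x.
Proof.
move=> [p [e [_ pe]]].
have [b bP] :=
  zfc_separation (zfcP M) p (interleave (fun=> point) (e tt)) a.
exists b => x; rewrite bP -[0]/(0.*2) upd_interleave.
by rewrite (pe tt) upd_eq.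
Qed.

Lemma replacement (R : M -> M -> Prop) a : definable2 R ->
  (forall x y z, x ∈ a -> R x y -> R x z -> y = z) ->
  exists b, forall y, y ∈ b <-> exists x, x ∈ a /\ R x y.
Proof.
move=> [p [e [_ pe]]] Rfun.
(* [interleave] puts the second argument at place 2 and the first parameter at place 1, while
   Replacement reads its arguments at places 0 and 1. *)
pose r k := if k == 1 then 2 else if k == 2 then 1 else k.
have rK : involutive r by move=> [|[|[|k]]].
pose v := interleave (fun=> point) (e tt) \o r.
have E x y : sat (upd (upd v 0 x) 1 y) (rename r p) <-> R x y.
  rewrite (sat_rename _ _ (inv_inj rK)).
  have -> : upd (upd v 0 x) 1 y \o r =
      interleave (upd (upd (fun=> point) 0 x) 1 y) (e tt).
    apply/funext => k; rewrite -(@upd_interleave _ _ _ 1) -(@upd_interleave _ _ _ 0).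
    by rewrite /v /upd /=; case: k => [|[|[|k]]].
  exact: (pe tt).
have Rfun' x y z : x ∈ a -> sat (upd (upd v 0 x) 1 y) (rename r p) ->
    sat (upd (upd v 0 x) 1 z) (rename r p) -> y = z.
  by move=> xa /E xy /E xz; apply: Rfun xy xz.
have [b bP] := zfc_replacement (zfcP M) Rfun'.
exists b => y; rewrite bP.
by split=> -[x [xa Rx]]; exists x; split=> //; apply/E.
Qed.

End Sets.

Ltac define :=
  match goal with
  | M : zfc_model |- _ => prove_def (point_admissible M)
  end.

(** * Pairs, functions, least fixed points and the natural numbers of [M] *)

Section BasicSets.
Variable M : zfc_model.
Implicit Types x y z a b c f r s p : M.

Lemma definable1_ext (P Q : M -> Prop) :
  (forall x, P x <-> Q x) -> definable1 Q -> definable1 P.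
Proof. by move=> PQ; apply: def_ext => _ v; rewrite PQ. Qed.

Definition emptyset : M := pick (@is_empty M).

Lemma in_empty x : ~ x ∈ emptyset.
Proof.
suff: is_empty emptyset by apply.
apply: (@pickP M (@is_empty M)).
have [b bP] := @separation M (fun x => ~ x = x) (point M) ltac:(define).
by exists b => z /bP [].
Qed.

Lemma is_emptyP x : is_empty x <-> x = emptyset.
Proof.
split=> [xE|->]; last exact: in_empty.
by apply: set_ext => z; split=> [/xE|/in_empty].
Qed.

Definition upair x y : M := pick (fun p => is_upair p x y).

Lemma in_upair z x y : z ∈ upair x y <-> z = x \/ z = y.
Proof. exact: (pickP (zfc_pairing (zfcP M) x y)). Qed.

Definition singleton x := upair x x.

Lemma in_singleton z x : z ∈ singleton x <-> z = x.
Proof. by rewrite in_upair; split=> [[]|->]; auto. Qed.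

Definition pair x y := upair (singleton x) (upair x y).

Lemma is_upairP p x y : is_upair p x y <-> p = upair x y.
Proof.
split=> [pP|-> z]; last exact: in_upair.
by apply: set_ext => z; rewrite pP in_upair.
Qed.

Lemma is_pairP p x y : is_pair p x y <-> p = pair x y.
Proof.
split=> [[a [b [/is_upairP -> /is_upairP -> /is_upairP ->]]] //|->].
by exists (singleton x), (upair x y); split; apply/is_upairP.
Qed.

Lemma pair_inj x y x' y' : pair x y = pair x' y' -> x = x' /\ y = y'.
Proof.
move=> E.
have xE : x = x'.
  have: singleton x' ∈ pair x y by rewrite E; apply/in_upair; left.
  move=> /in_upair[] E'.
    have: x' ∈ singleton x by rewrite -E'; apply/in_singleton.
    by move=> /in_singleton.
  have: x ∈ singleton x' by rewrite E'; apply/in_upair; left.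
  by move=> /in_singleton.
subst x'; split=> //.
have yy a b : pair x a = pair x b -> b = x \/ b = a.
  move=> {}E; have: upair x b ∈ pair x a by rewrite E; apply/in_upair; right.
  move=> /in_upair[] E'.
    have: b ∈ singleton x by rewrite -E'; apply/in_upair; right.
    by move=> /in_singleton; left.
  have: b ∈ upair x a by rewrite -E'; apply/in_upair; right.
  by move=> /in_upair.
by case: (yy _ _ E) (yy _ _ (esym E)) => [->|->//] [].
Qed.

Lemma pair_inE r x y : pair_in r x y <-> pair x y ∈ r.
Proof.
split=> [[p [/is_pairP -> //]]|pr]; exists (pair x y); split=> //.
exact/is_pairP.
Qed.

Definition bigunion x : M :=
  pick (fun u => forall z, z ∈ u <-> exists y, z ∈ y /\ y ∈ x).

Lemma in_bigunion z x : z ∈ bigunion x <-> exists y, z ∈ y /\ y ∈ x.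
Proof. exact: (pickP (zfc_union (zfcP M) x)). Qed.

Definition cup x y := bigunion (upair x y).

Lemma in_cup z x y : z ∈ cup x y <-> z ∈ x \/ z ∈ y.
Proof.
rewrite in_bigunion; split=> [[t [zt /in_upair[]<-]]|[]]; auto.
  by exists x; split=> //; apply/in_upair; left.
by exists y; split=> //; apply/in_upair; right.
Qed.

Definition adjoin x y := cup x (singleton y).

Lemma in_adjoin z x y : z ∈ adjoin x y <-> z ∈ x \/ z = y.
Proof. by rewrite in_cup in_singleton. Qed.

Definition power x : M := pick (fun u => forall z, z ∈ u <-> subset_in z x).

Lemma in_power z x : z ∈ power x <-> subset_in z x.
Proof. exact: (pickP (zfc_powerset (zfcP M) x)). Qed.

Definition product x y : M := pick (fun u => forall p,
  p ∈ u <-> exists s t, [/\ s ∈ x, t ∈ y & p = pair s t]).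

Lemma in_product p x y :
  p ∈ product x y <-> exists s t, [/\ s ∈ x, t ∈ y & p = pair s t].
Proof.
move: p; apply: (@pickP M (fun u => forall p, p ∈ u <-> _)).
have [b bP] := @separation M
  (fun p => exists s t, [/\ s ∈ x, t ∈ y & is_pair p s t])
  (power (power (cup x y))) ltac:(define).
exists b => p; rewrite bP; split=> [[_ [s [t [sx ty /is_pairP]]]]|].
  by exists s, t.
move=> [s [t [sx ty ->]]]; split; last by exists s, t; split=> //; apply/is_pairP.
apply/in_power => z /in_upair[]->; apply/in_power => q.
  by move=> /in_singleton ->; apply/in_cup; left.
by move=> /in_upair[]->; apply/in_cup; [left|right].
Qed.

Lemma pair_in_product s t x y : pair s t ∈ product x y <-> s ∈ x /\ t ∈ y.
Proof.
rewrite in_product; split=> [[s' [t' [sx ty /pair_inj[-> ->]]]] //|[sx ty]].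
by exists s, t.
Qed.

Lemma in_irrefl x : ~ x ∈ x.
Proof.
move=> xx; have [|y [/in_singleton -> []]] :=
    zfc_foundation (zfcP M) (x := singleton x).
  by exists x; apply/in_singleton.
by exists x; split=> //; apply/in_singleton.
Qed.

Lemma in_asym x y : x ∈ y -> ~ y ∈ x.
Proof.
move=> xy yx; have [|z [/in_upair[]-> []]] :=
    zfc_foundation (zfcP M) (x := upair x y).
- by exists x; apply/in_upair; left.
- by exists y; split=> //; apply/in_upair; right.
- by exists x; split=> //; apply/in_upair; left.
Qed.

Definition apply f x : M := pick (fun y => pair_in f x y).

Lemma apply_in f a b x : is_function f a b -> x ∈ a -> apply f x ∈ b.
Proof.
move=> [fab fun_f] /fun_f[y [fxy _]].
have /pair_inE/fab[s [t [_ tb /is_pairP/pair_inj[_ ->]]]] //: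
  pair_in f x (apply f x) by apply: (@pickP M); exists y.
Qed.

Lemma applyP f a b x y : is_function f a b ->
  pair_in f x y <-> x ∈ a /\ apply f x = y.
Proof.
move=> [fab fun_f].
have fx : x ∈ a -> pair_in f x (apply f x).
  by move=> /fun_f[z [fxz _]]; apply: (@pickP M); exists z.
split=> [fxy|[xa <-]]; last exact: fx.
have xa : x ∈ a.
  by move/pair_inE/fab: fxy => [s [t [sa _ /is_pairP/pair_inj[->]]]].
by split=> //; have [z [_ zu]] := fun_f x xa; rewrite -(zu _ fxy) (zu _ (fx xa)).
Qed.

Lemma function_ext f g a b b' : is_function f a b -> is_function g a b' ->
  (forall x, x ∈ a -> apply f x = apply g x) -> f = g.
Proof.
move=> ff gg fg.
have sub f1 g1 b1 b2 : is_function f1 a b1 -> is_function g1 a b2 ->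
  (forall x, x ∈ a -> apply f1 x = apply g1 x) -> forall p, p ∈ f1 -> p ∈ g1.
  move=> f1f g1f E p pf; have [/(_ p pf) [x [y [_ _ /is_pairP pE]]] _] := f1f.
  move: pf; rewrite pE => /pair_inE/(applyP _ _ f1f) [xa].
  by rewrite E // => yE; apply/pair_inE/(applyP _ _ g1f).
apply: set_ext => p; split; first exact: sub ff gg fg _.
by apply: sub gg ff _ _ => x xa; rewrite fg.
Qed.

Lemma relation_function (R : M -> M -> Prop) a b :
  definable1 (fun p => exists x y, is_pair p x y /\ R x y) ->
  (forall x, x ∈ a -> exists y, y ∈ b /\ R x y) ->
  (forall x y z, x ∈ a -> R x y -> R x z -> y = z) ->
  exists f, is_function f a b /\ forall x, x ∈ a -> R x (apply f x).
Proof.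
move=> dR Rtot Rfun.
have [f fP] := separation (product a b) dR.
have fE x y : pair_in f x y <-> [/\ x ∈ a, y ∈ b & R x y].
  rewrite pair_inE fP pair_in_product; split=> [[[xa yb] [x' [y' []]]]|[xa yb xy]].
    by move=> /is_pairP/pair_inj[<- <-].
  by split=> //; exists x, y; split=> //; apply/is_pairP.
have ff : is_function f a b.
  split=> [p /fP[/in_product[x [y [xa yb ->]]] _]|x xa].
    by exists x, y; split=> //; apply/is_pairP.
  have [y [yb xy]] := Rtot x xa; exists y; split; first exact/fE.
  by move=> z /fE[_ _]; apply: Rfun xy.
exists f; split=> // x xa.
by have /fE[] : pair_in f x (apply f x) by apply/(applyP _ _ ff).
Qed.

(* Knaster-Tarski *)
Lemma least_fixpoint (G : M -> M -> Prop) b :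
  definable1 (fun p => forall y : M, (forall q, q ∈ b -> G y q -> q ∈ y) ->
    p ∈ y) ->
  (forall x, definable1 (G x)) ->
  (forall x y p, subset_in x y -> G x p -> G y p) ->
  exists x, (forall p, p ∈ x <-> p ∈ b /\ G x p) /\
    forall y, (forall q, q ∈ b -> G y q -> q ∈ y) -> subset_in x y.
Proof.
move=> dlfp dG Gmono; have [x xP] := separation b dlfp.
have x_least y : (forall q, q ∈ b -> G y q -> q ∈ y) -> subset_in x y.
  by move=> yG z /xP [_ /(_ y yG)].
have xG p : p ∈ b -> G x p -> p ∈ x.
  move=> pb Gp; apply/xP; split=> // y yG; apply: (yG) => //.
  by apply: Gmono Gp; exact: x_least yG.
exists x; split=> // p; split=> [px|[pb]]; last exact: xG.
split; first by move/xP: px => [].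
have [y yP] := separation x (dG x).
have /x_least /(_ p px) : forall q, q ∈ b -> G y q -> q ∈ y; last by move=> /yP[].
move=> q qb Gq; have {}Gq: G x q by apply: Gmono Gq => z /yP[].
by apply/yP; split=> //; apply: xG.
Qed.

Definition succ x := adjoin x x.

Lemma is_succP s x : is_succ s x <-> s = succ x.
Proof.
split=> [sP|-> z]; last by rewrite in_adjoin.
by apply: set_ext => z; rewrite sP in_adjoin.
Qed.

Lemma in_succ z x : z ∈ succ x <-> z ∈ x \/ z = x.
Proof. exact: in_adjoin. Qed.

Lemma succ_inj x y : succ x = succ y -> x = y.
Proof.
move=> E; have: x ∈ succ y by rewrite -E; apply/in_succ; right.
have: y ∈ succ x by rewrite E; apply/in_succ; right.
by move=> /in_succ[yx|->//] /in_succ[xy|//]; case: (in_asym xy yx).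
Qed.

Lemma succ_neq0 x : succ x <> emptyset.
Proof. by move=> E; apply: (@in_empty x); rewrite -E; apply/in_succ; right. Qed.

Lemma inductive_setP w : inductive_set w <->
  emptyset ∈ w /\ forall n, n ∈ w -> succ n ∈ w.
Proof.
split=> [[[e [/is_emptyP -> ew]] wS]|[w0 wS]].
  by split=> // n /wS[s [/is_succP ->]].
split; first by exists emptyset; split=> //; apply/is_emptyP.
by move=> n /wS nw; exists (succ n); split=> //; apply/is_succP.
Qed.

Definition omega : M := pick (@is_omega M).

Lemma omegaP : is_omega omega.
Proof.
apply: (@pickP M); have [i iP] := zfc_infinity (zfcP M).
have [w wP] := @separation M (fun x => forall z, inductive_set z -> x ∈ z) i
  ltac:(define).
have winP z : inductive_set z -> subset_in w z by move=> zP x /wP[_ /(_ z zP)].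
exists w; split=> //; move/inductive_setP: (iP) => [i0 iS]; apply/inductive_setP.
split; first by apply/wP; split=> // z /inductive_setP[].
move=> n nw; apply/wP; split; first by apply: iS; apply: winP nw.
by move=> z zP; move/inductive_setP: (zP) => [_]; apply; apply: winP nw.
Qed.

Lemma is_omegaP w : is_omega w <-> w = omega.
Proof.
split=> [[wi wl]|->]; last exact: omegaP.
have [oi ol] := omegaP.
by apply: set_ext => z; split; [apply: wl | apply: ol].
Qed.

Lemma omega0 : emptyset ∈ omega.
Proof. by have [/inductive_setP[]] := omegaP. Qed.

Lemma omegaS n : n ∈ omega -> succ n ∈ omega.
Proof. by have [/inductive_setP[_ oS] _] := omegaP; apply: oS. Qed.

Lemma omega_ind (P : M -> Prop) : definable1 P -> P emptyset ->
  (forall n, n ∈ omega -> P n -> P (succ n)) -> forall n, n ∈ omega -> P n.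
Proof.
move=> dP P0 PS; have [b bP] := separation omega dP.
have [_ /(_ b)] := omegaP; have: inductive_set b.
  apply/inductive_setP; split; first by apply/bP; split=> //; apply: omega0.
  by move=> n /bP[no Pn]; apply/bP; split; [apply: omegaS | apply: PS].
by move=> /[swap]/[apply] sub n /sub/bP[].
Qed.

Lemma omega_trans n k : n ∈ omega -> k ∈ n -> k ∈ omega.
Proof.
move=> no; move: n no k; apply: omega_ind; first by define.
  by move=> k /in_empty.
by move=> n no IH k /in_succ[/IH|->].
Qed.

Lemma mem_trans n k l : n ∈ omega -> k ∈ n -> l ∈ k -> l ∈ n.
Proof.
move=> no; move: n no k l; apply: omega_ind; first by define.
  by move=> k l /in_empty.
move=> n no IH k l /in_succ[kn lk|-> lk]; apply/in_succ; left=> //.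
exact: IH kn lk.
Qed.

Lemma mem0_omega n : n ∈ omega -> n = emptyset \/ emptyset ∈ n.
Proof.
move: n; apply: omega_ind => [||n no]; last first.
- by move=> [->|n0]; right; apply/in_succ; [right|left].
- by left.
apply: (@definable1_ext _ (fun n => is_empty n \/
  exists e : M, is_empty e /\ e ∈ n)); last by define.
move=> n; rewrite is_emptyP; split=> -[]; auto.
  by right; exists emptyset; split=> //; apply/is_emptyP.
by move=> [e [/is_emptyP ->]]; right.
Qed.

Lemma succ_mem n k : n ∈ omega -> k ∈ n -> succ k ∈ n \/ succ k = n.
Proof.
move=> no kn.
suff: forall k : M, k ∈ n -> exists s : M, is_succ s k /\ (s ∈ n \/ s = n).
  by move=> /(_ k kn)[s [/is_succP ->]].
move: n no {k kn}; apply: omega_ind; first by define.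
  by move=> k /in_empty.
move=> n no IH k /in_succ[/IH[s [sk sn]]|->]; last first.
  by exists (succ n); split; [apply/is_succP|right].
by exists s; split=> //; left; apply/in_succ.
Qed.

Lemma omega_total n k : n ∈ omega -> k ∈ omega -> [\/ n ∈ k, n = k | k ∈ n].
Proof.
move=> no ko; suff: n ∈ k \/ n = k \/ k ∈ n.
  by move=> [|[]] ?; [apply: Or31|apply: Or32|apply: Or33].
move: n no k ko.
suff: forall n, n ∈ omega -> forall k, k ∈ omega -> n ∈ k \/ n = k \/ k ∈ n by [].
apply: omega_ind; first by define.
  by move=> k /mem0_omega[]; auto.
move=> n no IH k ko; case: (IH k ko) => [nk|[->|kn]].
- by case: (succ_mem ko nk); auto.
- by right; right; apply/in_succ; right.
- by right; right; apply/in_succ; left.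
Qed.

Lemma omega_max n k : n ∈ omega -> k ∈ omega ->
  exists m, [/\ m ∈ omega, subset_in n m & subset_in k m].
Proof.
move=> no ko; case: (omega_total no ko) => [nk|->|kn].
- by exists k; split=> // l; apply: mem_trans nk.
- by exists k; split.
- by exists n; split=> // l; apply: mem_trans kn.
Qed.

Fixpoint numeral k : M := if k is k'.+1 then succ (numeral k') else emptyset.

Lemma is_numeralP k x : is_numeral k x <-> x = numeral k.
Proof.
elim: k x => [|k IH] x /=; first exact: is_emptyP.
split=> [[y [/IH -> /is_succP//]]|->].
by exists (numeral k); split; [apply/IH|apply/is_succP].
Qed.

Lemma numeral_omega k : numeral k ∈ omega.
Proof. by elim: k => [|k IH] /=; [apply: omega0|apply: omegaS]. Qed.

Lemma numeral_inj : injective numeral.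
Proof.
elim=> [|k IH] [|l] //=; first by move/esym/succ_neq0.
  by move/succ_neq0.
by move/succ_inj/IH ->.
Qed.

Definition tag k x := pair (numeral k) x.
Definition tag2 k x y := tag k (pair x y).

Lemma taggedP k x c : tagged k x c <-> c = tag k x.
Proof.
split=> [[n [/is_numeralP -> /is_pairP//]]|->].
by exists (numeral k); split; [apply/is_numeralP|apply/is_pairP].
Qed.

Lemma tagged2P k x y c : tagged2 k x y c <-> c = tag2 k x y.
Proof.
split=> [[n [/is_pairP -> /taggedP//]]|->].
by exists (pair x y); split; [apply/is_pairP|apply/taggedP].
Qed.

Lemma tag_inj k l x y : tag k x = tag l y -> k = l /\ x = y.
Proof. by move=> /pair_inj[/numeral_inj]. Qed.

Lemma tag2_inj k l x y x' y' :
  tag2 k x y = tag2 l x' y' -> [/\ k = l, x = x' & y = y'].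
Proof. by move=> /tag_inj[-> /pair_inj[-> ->]]. Qed.

(* Kuratowski's definition of finiteness. *)
Definition finite x := forall t : M, (exists e, is_empty e /\ e ∈ t) ->
  (forall y z u : M, y ∈ t -> z ∈ x ->
     (forall q : M, q ∈ u <-> q ∈ y \/ q = z) -> u ∈ t) -> x ∈ t.

End BasicSets.

(** * Finite sets, and a set closed under finite subsets *)

#[global] Hint Unfold finite : definability.

Section Finite.
Variable M : zfc_model.
Implicit Types x y z a b c f r s p u n : M.

Lemma adjoinP u y z : (forall q, q ∈ u <-> q ∈ y \/ q = z) -> u = adjoin y z.
Proof. by move=> uP; apply: set_ext => q; rewrite uP in_adjoin. Qed.

Lemma finite_ind (P : M -> Prop) : definable1 P -> P (emptyset M) ->
  (forall y z, P y -> P (adjoin y z)) -> forall x, finite x -> P x.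
Proof.
move=> dP P0 PS x xfin; have [t tP] := separation (power x) dP.
suff /tP[] : x ∈ t by [].
apply: xfin.
  exists (emptyset M); split; first exact/is_emptyP.
  by apply/tP; split=> //; apply/in_power => z /in_empty.
move=> y z u /tP[/in_power yx Py] zx /adjoinP ->; apply/tP; split.
  by apply/in_power => q /in_adjoin[/yx|->].
exact: PS.
Qed.

Lemma finite_empty : finite (emptyset M).
Proof. by move=> t [e [/is_emptyP ->]]. Qed.

Lemma finite_adjoin y z : finite y -> finite (adjoin y z).
Proof.
move=> yfin t t0 tS; apply: (tS y z); last by move=> q; rewrite in_adjoin.
- apply: yfin => // y' z' u y't z'y; apply: tS => //.
  by apply/in_adjoin; left.
- by apply/in_adjoin; right.
Qed.

Lemma finite_singleton z : finite (singleton z).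
Proof.
have -> : singleton z = adjoin (emptyset M) z.
  by apply: adjoinP => q; rewrite in_singleton; split=> [|[/in_empty|]]; auto.
exact: finite_adjoin finite_empty.
Qed.

Lemma finite_cup x y : finite x -> finite y -> finite (cup x y).
Proof.
move=> xfin yfin.
suff: forall u, (forall z, z ∈ u <-> z ∈ x \/ z ∈ y) -> finite u.
  by apply=> z; rewrite in_cup.
move: x xfin; apply: finite_ind; first by define.
  move=> u uP; suff -> : u = y by [].
  by apply: set_ext => z; rewrite uP; split=> [[/in_empty|]|]; auto.
move=> x' z IH u uP.
have -> : u = adjoin (cup x' y) z.
  apply: adjoinP => q; rewrite uP in_cup in_adjoin; tauto.
by apply: finite_adjoin; apply: IH => q; rewrite in_cup.
Qed.

Lemma finite_omega n : n ∈ omega M -> finite n.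
Proof.
move: n; apply: omega_ind; first by define.
- exact: finite_empty.
- by move=> n _; apply: finite_adjoin.
Qed.

(** By induction on [a]: as [r] is functional, an element added to [a] contributes at most one
    element of [u] that does not come from the rest of [a]. *)
Lemma finite_image r a u :
  (forall x y z, pair_in r x y -> pair_in r x z -> y = z) -> finite a ->
  (forall y, y ∈ u -> exists x, x ∈ a /\ pair_in r x y) -> finite u.
Proof.
move=> rfun afin; move: u.
move: a afin; apply: finite_ind; first by define.
  move=> u uP; suff -> : u = emptyset M by apply: finite_empty.
  apply: set_ext => y; split=> [/uP[x [/in_empty]]|/in_empty] //.
move=> c z IH u uP.
have [u' u'P] := @separation M (fun y => exists x, x ∈ c /\ pair_in r x y) u
  ltac:(define).
have u'fin : finite u' by apply: IH => y /u'P[].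
case: (EM (exists y, y ∈ u /\ ~ y ∈ u')) => [[y [yu yu']]|no]; last first.
  suff -> : u = u' by [].
  apply: set_ext => y; split=> [yu|/u'P[]//]; apply: contrapT => yu'.
  by apply: no; exists y.
have yz : pair_in r z y.
  have [x [/in_adjoin[xc|->//] xy]] := uP y yu.
  by case: yu'; apply/u'P; split=> //; exists x.
suff -> : u = adjoin u' y by apply: finite_adjoin.
apply: set_ext => q; rewrite in_adjoin; split=> [qu|[/u'P[]//|->//]].
have [x [/in_adjoin[xc|->] xy]] := uP q qu.
  by left; apply/u'P; split=> //; exists x.
by right; apply: rfun xy yz.
Qed.

Lemma function_functional f a b x y z : is_function f a b ->
  pair_in f x y -> pair_in f x z -> y = z.
Proof. by move=> ff /(applyP _ _ ff)[_ <-] /(applyP _ _ ff)[_ <-]. Qed.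

Lemma is_finite_finite x : is_finite x -> finite x.
Proof.
move=> [w [n [f [/is_omegaP -> nw [ff fbij]]]]].
apply: (finite_image (r := f) (a := n)) (finite_omega nw) _.
  by move=> *; apply: function_functional ff _ _; eassumption.
move=> y /fbij[i [iy _]]; exists i; split=> //.
by case/(applyP _ _ ff): iy.
Qed.

Lemma finite_function f a b : is_function f a b -> finite a -> finite f.
Proof.
move=> ff afin.
have [r [rf rP]] : exists r, is_function r a f /\ forall x, x ∈ a ->
    exists y, is_pair (apply r x) x y /\ pair_in f x y.
  apply: (@relation_function M (fun x p =>
    exists y, is_pair p x y /\ pair_in f x y)); first by define.
  - move=> x xa; have fx : pair_in f x (apply f x) by apply/(applyP _ _ ff).
    exists (pair x (apply f x)); split; first exact/pair_inE.
    by exists (apply f x); split=> //; apply/is_pairP.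
  - move=> x p q _ [y [/is_pairP -> xy]] [z [/is_pairP -> xz]].
    by rewrite (function_functional ff xy xz).
apply: (finite_image (r := r)) afin _.
  by move=> *; apply: function_functional rf _ _; eassumption.
move=> p pf; have [/(_ p pf)[x [y [xa yb /is_pairP pE]]] _] := ff.
exists x; split=> //; apply/(applyP _ _ rf); split=> //.
have [z [/is_pairP -> xz]] := rP x xa.
rewrite pE (function_functional ff xz (z := y)) //.
by apply/pair_inE; rewrite -pE.
Qed.

End Finite.

(* A set closed under pairing and finite subsets, obtained by iterating
   [Y |-> Y u P(Y)] through omega. It bounds the sets of terms and formulas. *)
Section FiniteClosure.
Variables (M : zfc_model) (base : M).
Implicit Types x y z a b c f r s p u n A Y : M.

Definition level_step Y Y' := forall z, z ∈ Y' <-> z ∈ Y \/ subset_in z Y.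

Definition level_history A := forall n Y, pair_in A n Y ->
  (is_empty n /\ Y = base) \/
  exists n' Y', [/\ pair_in A n' Y', is_succ n n' & level_step Y' Y].

Definition level n Y := exists A, level_history A /\ pair_in A n Y.

Hint Unfold level_step level_history level : definability.

Lemma level_stepP Y Y' : level_step Y Y' <-> Y' = cup Y (power Y).
Proof.
split=> [YY|-> z]; last by rewrite in_cup in_power.
by apply: set_ext => z; rewrite YY in_cup in_power.
Qed.

Lemma level0P Y : level (emptyset M) Y -> Y = base.
Proof.
move=> [A [Ah /Ah[[]//|[n' [Y' [_ /is_succP/esym/succ_neq0]]]]]] //.
Qed.

Lemma levelSP n Y : level (succ n) Y ->
  exists Y', level n Y' /\ Y = cup Y' (power Y').
Proof.
move=> [A [Ah /Ah[[/is_emptyP/succ_neq0]//|[n' [Y' [An' /is_succP/succ_inj nE]]]]]].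
by move=> /level_stepP ->; exists Y'; split=> //; exists A; rewrite nE.
Qed.

Lemma level_unique n : n ∈ omega M ->
  forall Y Y', level n Y -> level n Y' -> Y = Y'.
Proof.
move: n; apply: omega_ind; first by define.
  by move=> Y Y' /level0P -> /level0P ->.
by move=> n _ IH Y Y' /levelSP[Z [nZ ->]] /levelSP[Z' [/(IH _ _ nZ) <- ->]].
Qed.

Lemma level0 : level (emptyset M) base.
Proof.
exists (singleton (pair (emptyset M) base)); split.
  move=> n Y /pair_inE/in_singleton/pair_inj[-> ->].
  by left; split=> //; apply/is_emptyP.
exact/pair_inE/in_singleton.
Qed.

Lemma levelS n Y : level n Y -> level (succ n) (cup Y (power Y)).
Proof.
move=> [A [Ah An]]; exists (adjoin A (pair (succ n) (cup Y (power Y)))); split.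
  have AA m Z : pair_in A m Z ->
      pair_in (adjoin A (pair (succ n) (cup Y (power Y)))) m Z.
    by move=> /pair_inE AmZ; apply/pair_inE/in_adjoin; left.
  move=> m Z /pair_inE/in_adjoin[/pair_inE/Ah[?|[m' [Z' [AZ' mm ZZ]]]]|].
  - by left.
  - by right; exists m', Z'; split=> //; apply: AA.
  - move=> /pair_inj[-> ->]; right; exists n, Y; split; first exact: AA.
      exact/is_succP.
    exact/level_stepP.
by apply/pair_inE/in_adjoin; right.
Qed.

Lemma level_exists n : n ∈ omega M -> exists Y, level n Y.
Proof.
move: n; apply: omega_ind; first by define.
- by exists base; apply: level0.
- by move=> n _ [Y nY]; exists (cup Y (power Y)); apply: levelS.
Qed.

Lemma level_mono n : n ∈ omega M -> forall m, m ∈ n -> forall Y Y',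
  level m Y -> level n Y' -> subset_in Y Y'.
Proof.
move: n; apply: omega_ind; first by define.
  by move=> m /in_empty.
move=> n no IH m mn Y Y' mY /levelSP[Z [nZ ->]] z zY; apply/in_cup; left.
move/in_succ: mn => [mn|mE]; first exact: IH mn _ _ mY nZ _ zY.
by rewrite mE in mY; rewrite (level_unique no nZ mY).
Qed.

(** The levels increase, so a finite subset of their union lies in a single level and is an element
    of the next. Closure under pairs follows, since unordered pairs are finite. *)
Lemma finite_closure : exists V : M, [/\ subset_in base V,
  forall x y, x ∈ V -> y ∈ V -> pair x y ∈ V &
  forall x, finite x -> subset_in x V -> x ∈ V].
Proof.
have [U UP] := @replacement M (fun n Y => n ∈ omega M /\ level n Y) (omega M)
  ltac:(define) ltac:(by move=> n Y Y' no [_ nY] [_]; apply: level_unique nY).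
exists (bigunion U).
have VP x : x ∈ bigunion U <-> exists n Y, [/\ n ∈ omega M, level n Y & x ∈ Y].
  rewrite in_bigunion; split=> [[Y [xY /UP[n [no [_ nY]]]]]|[n [Y [no nY xY]]]].
    by exists n, Y.
  by exists Y; split=> //; apply/UP; exists n.
have VS n Y x : n ∈ omega M -> level n Y -> subset_in x Y -> x ∈ bigunion U.
  move=> no nY xY; apply/VP; exists (succ n), (cup Y (power Y)).
  by split; [apply: omegaS|apply: levelS|apply/in_cup; right; apply/in_power].
have level_le n m Y Y' : n ∈ omega M -> m ∈ omega M -> level n Y ->
    level m Y' -> subset_in n m -> subset_in Y Y'.
  move=> no mo nY mY' nm; case: (omega_total no mo) => [H|H|H].
  - exact: level_mono nY mY'.
  - by rewrite H in nY; rewrite (level_unique mo mY' nY).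
  - by have /in_irrefl := nm _ H.
have Vfin x : finite x -> subset_in x (bigunion U) -> x ∈ bigunion U.
  move=> xfin xV.
  suff [n [no [Y [nY xY]]]] : exists n, n ∈ omega M /\ exists Y, level n Y /\
      subset_in x Y by apply: VS no nY xY.
  have {xV}: forall z, z ∈ x -> exists n Y, [/\ n ∈ omega M, level n Y & z ∈ Y].
    by move=> z /xV/VP.
  move: x xfin; apply: finite_ind; first by define.
    move=> _; exists (emptyset M); split; first exact: omega0.
    by exists base; split; [apply: level0|move=> z /in_empty].
  move=> x y IH xyV; have [|n [no [Y [nY xY]]]] := IH.
    by move=> z zx; apply: xyV; apply/in_adjoin; left.
  have [|m [Z [mo mZ yZ]]] := xyV y; first by apply/in_adjoin; right.
  have [k [ko nk mk]] := omega_max no mo; have [W kW] := level_exists ko.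
  exists k; split=> //; exists W; split=> // z /in_adjoin[/xY|->].
    exact: level_le nY kW nk _.
  exact: level_le mZ kW mk _ yZ.
have V2 x y : x ∈ bigunion U -> y ∈ bigunion U -> upair x y ∈ bigunion U.
  move=> xV yV; apply: Vfin; last by move=> z /in_upair[]->.
  have -> : upair x y = cup (singleton x) (singleton y).
    by apply: set_ext => z; rewrite in_cup !in_singleton in_upair.
  by apply: finite_cup; apply: finite_singleton.
split=> // [x xb|x y xV yV]; last first.
  exact: (V2 _ _ (V2 _ _ xV xV) (V2 _ _ xV yV)).
apply/VP; exists (emptyset M), base; split=> //; [exact: omega0|exact: level0].
Qed.

End FiniteClosure.

(** * Satisfaction inside the model *)

Section Semantics.
Variables (M : zfc_model) (N : structure M).
Implicit Types x y z a b c f r s p u n A B t i d R : M.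

Notation om := (omega M).
Notation D := (dom N).

Lemma arity_symbol c n : pair_in (ar N) c n ->
  (c ∈ rels N \/ c ∈ funs N) /\ n ∈ om.
Proof.
have [w [L [/is_omegaP -> LP arf]]] := ar_function N.
move=> cn; have [cL nE] := (applyP _ _ arf).1 cn; split; first exact/LP.
by rewrite -nE; apply: apply_in arf cL.
Qed.

Lemma arity_unique c n n' : pair_in (ar N) c n -> pair_in (ar N) c n' -> n = n'.
Proof. by have [w [L [_ _ arf]]] := ar_function N; apply: function_functional arf. Qed.

Lemma arity_exists c : c ∈ rels N \/ c ∈ funs N -> exists n, pair_in (ar N) c n.
Proof.
have [w [L [_ LP arf]]] := ar_function N; move=> /LP cL.
by have [_ /(_ c cL)[n [cn _]]] := arf; exists n.
Qed.

Lemma itp_unique c R R' : pair_in (itp N) c R -> pair_in (itp N) c R' -> R = R'.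
Proof. by have [L [B [_ itpf]]] := itp_function N; apply: function_functional itpf. Qed.

Lemma itp_fun_value c n f t y : c ∈ funs N -> pair_in (ar N) c n ->
  pair_in (itp N) c f -> pair_in f t y -> is_function t n D /\ y ∈ D.
Proof.
move=> cf cn cff ty; have [P [PP ff]] := itp_fun cf cn cff.
have [tP <-] := (applyP _ _ ff).1 ty; split; first exact/PP.
exact: apply_in ff tP.
Qed.

Definition assignments : M := pick (fun A => forall s,
  s ∈ A <-> is_assignment N om s).

Lemma in_assignments s : s ∈ assignments <-> is_assignment N om s.
Proof.
move: s; apply: (@pickP M (fun A => forall s, s ∈ A <-> _)).
have [A AP] := @separation M (is_assignment N om) (power (product om D))
  ltac:(define).
exists A => s; rewrite AP; split=> [[]//|sa]; split=> //; apply/in_power => p ps.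
have [/(_ p ps)[x [y [xo yd /is_pairP ->]]] _] := sa.
exact/pair_in_product.
Qed.

Lemma function_sub u n a b : subset_in a b -> is_function u n a ->
  is_function u n b.
Proof.
move=> ab [ua uf]; split=> // p /ua[x [y [xn ya pE]]].
by exists x, y; split=> //; apply: ab.
Qed.

Variable V0 : M.
Hypothesis V0_omega : subset_in om V0.
Hypothesis V0_rels : subset_in (rels N) V0.
Hypothesis V0_funs : subset_in (funs N) V0.
Hypothesis V0_pair : forall x y, x ∈ V0 -> y ∈ V0 -> pair x y ∈ V0.
Hypothesis V0_finite : forall x, finite x -> subset_in x V0 -> x ∈ V0.

Lemma tag_V0 k x : x ∈ V0 -> tag k x ∈ V0.
Proof. by apply: V0_pair; apply: V0_omega; apply: numeral_omega. Qed.

Lemma tag2_V0 k x y : x ∈ V0 -> y ∈ V0 -> tag2 k x y ∈ V0.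
Proof. by move=> xV yV; apply: tag_V0; apply: V0_pair. Qed.

Lemma tuple_V0 u n a : n ∈ om -> subset_in a V0 -> is_function u n a -> u ∈ V0.
Proof.
move=> no aV uf; apply: V0_finite; first exact: finite_function uf (finite_omega no).
have [ua _] := uf => p /ua[x [y [xn ya /is_pairP ->]]].
by apply: V0_pair; [apply: V0_omega; apply: omega_trans xn | apply: aV].
Qed.

(** [V0] is closed under the constructors of terms, so the least fixed point of one construction
    step, taken inside [V0], is closed and lies in every closed set. *)
Lemma term_set_exists : exists T, is_term_set N om T /\ subset_in T V0.
Proof.
have [|||T [TP Tleast]] := @least_fixpoint M (fun X c =>
  (exists i, i ∈ om /\ tagged 0 i c) \/
  (exists f n u, [/\ f ∈ funs N, pair_in (ar N) f n, is_function u n X &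
     tagged2 1 f u c])) V0.
- by define.
- by move=> X; define.
- move=> X Y c XY [|[f [n [u [ff fn uX cE]]]]]; first by left.
  by right; exists f, n, u; split=> //; apply: function_sub uX.
have TV : subset_in T V0 by move=> c /TP[].
exists T; split=> //; split; first split.
- move=> i c io cE; apply/TP; split; last by left; exists i.
  by rewrite ((taggedP _ _ _).1 cE); apply: tag_V0; apply: V0_omega.
- move=> f n u c ff fn uT cE; apply/TP; split; last by right; exists f, n, u.
  rewrite ((tagged2P _ _ _ _).1 cE); apply: tag2_V0; first exact: V0_funs.
  by apply: tuple_V0 TV uT; case/arity_symbol: fn.
- move=> X [Xv Xf]; apply: Tleast => c _ [[i [io cE]]|[f [n [u [ff fn uX cE]]]]].
    exact: Xv cE.
  exact: Xf uX cE.
Qed.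

Variable T : M.
Hypothesis T_term : is_term_set N om T.
Hypothesis T_V0 : subset_in T V0.

(** The clauses for terms are positive in [V], so any fixed point will do. Distinct tags and the
    uniqueness of arities leave one applicable clause for each term. *)
Lemma evaluation_exists : exists V, is_evaluation N om T V.
Proof.
have [|||V [VP _]] := @least_fixpoint M (fun X p =>
  exists c s d q, is_pair q c s /\ is_pair p q d /\
  ((exists i, [/\ i ∈ om, tagged 0 i c & pair_in s i d]) \/
   (exists f n u, [/\ f ∈ funs N, pair_in (ar N) f n, is_function u n T &
     tagged2 1 f u c] /\ exists y g, [/\ tuple_value N X n u s y,
       pair_in (itp N) f g & pair_in g y d])))
  (product (product T assignments) D).
- by define.
- by move=> X; define.
- move=> X Y p XY [c [s [d [q [qE [pE H]]]]]]; exists c, s, d, q; split=> //.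
  split=> //; case: H => [?|[f [n [u [H [y [g [[yf yv] ? ?]]]]]]]]; first by left.
  right; exists f, n, u; split=> //; exists y, g; split=> //; split=> //.
  move=> k t a kt ka; have [z [? zX]] := yv k t a kt ka; exists z; split=> //.
  by move/pair_inE: zX => zX; apply/pair_inE; apply: XY.
have valE c s d : value V c s d <-> pair (pair c s) d ∈ V.
  split=> [[p [/is_pairP -> /pair_inE//]]|H]; exists (pair c s).
  by split; [apply/is_pairP|apply/pair_inE].
exists V; split.
- move=> i c s d io /taggedP cE sa; rewrite valE VP; split=> [[_]|sd].
    move=> [c' [s' [d' [q [/is_pairP -> [/is_pairP]]]]]].
    move=> /pair_inj[/pair_inj[<- <-] <-].
    rewrite cE => -[[i' [_ /taggedP/tag_inj[_ <-]]] //|].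
    by move=> [f [n [u [[_ _ _ /tagged2P/tag_inj[]]]]]].
  split.
    apply/pair_in_product; split; last first.
      by have := (applyP _ _ sa).1 sd => -[_ <-]; apply: apply_in sa io.
    apply/pair_in_product; split; last exact/in_assignments.
    by case: T_term => [[Tv _] _]; apply: Tv io _; apply/taggedP.
  exists c, s, d, (pair c s); split; first exact/is_pairP.
  split; first exact/is_pairP.
  by left; exists i; split=> //; apply/taggedP.
- move=> f n u c s d ff fn uT cE sa; rewrite valE VP; split=> [[_]|].
    move=> [c' [s' [d' [q [/is_pairP -> [/is_pairP]]]]]].
    move=> /pair_inj[/pair_inj[<- <-] <-].
    move: cE => /tagged2P ->.
    move=> [[i' [_ /taggedP/tag_inj[]//]]|].
    move=> [f' [n' [u' [[_ fn' _ /tagged2P/tag2_inj[_ fE uE]]]]]].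
    by subst f' u'; rewrite (arity_unique fn fn').
  move=> [y [g [[yf yv] fg gyd]]]; split.
    apply/pair_in_product; split; last exact: (itp_fun_value ff fn fg gyd).2.
    apply/pair_in_product; split; last exact/in_assignments.
    by case: T_term => [[_ Tf] _]; apply: Tf ff fn uT cE.
  exists c, s, d, (pair c s); split; first exact/is_pairP.
  split; first exact/is_pairP.
  by right; exists f, n, u; split=> //; exists y, g; split.
Qed.

Lemma form_set_exists : exists F, is_form_set N om T F.
Proof.
have [|||F [FP Fleast]] := @least_fixpoint M (fun X c =>
  (exists t t', [/\ t ∈ T, t' ∈ T & tagged2 2 t t' c]) \/
  (exists r n u, [/\ r ∈ rels N, pair_in (ar N) r n, is_function u n T &
     tagged2 3 r u c]) \/
  (exists a, a ∈ X /\ tagged 4 a c) \/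
  (exists a b, [/\ a ∈ X, b ∈ X & tagged2 5 a b c]) \/
  (exists i a, [/\ i ∈ om, a ∈ X & tagged2 6 i a c])) V0.
- by define.
- by move=> X; define.
- move=> X Y c XY [|[|[|[|]]]]; first by left.
  + by right; left.
  + by move=> [a [aX cE]]; do 2 right; left; exists a; split=> //; apply: XY.
  + move=> [a [b [aX bX cE]]]; do 3 right; left; exists a, b.
    by split=> //; apply: XY.
  + move=> [a [b [aX bX cE]]]; do 4 right; exists a, b.
    by split=> //; apply: XY.
have FV : subset_in F V0 by move=> c /FP[].
exists F; split; first split.
- move=> t t' c tT t'T cE; apply/FP; split; last by left; exists t, t'.
  by rewrite ((tagged2P _ _ _ _).1 cE); apply: tag2_V0; apply: T_V0.
- move=> r n u c rr rn uT cE; apply/FP; split; last by right; left; exists r, n, u.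
  rewrite ((tagged2P _ _ _ _).1 cE); apply: tag2_V0; first exact: V0_rels.
  by apply: tuple_V0 T_V0 uT; case/arity_symbol: rn.
- move=> a c aF cE; apply/FP; split; last by do 2 right; left; exists a.
  by rewrite ((taggedP _ _ _).1 cE); apply: tag_V0; apply: FV.
- move=> a b c aF bF cE; apply/FP; split; last by do 3 right; left; exists a, b.
  by rewrite ((tagged2P _ _ _ _).1 cE); apply: tag2_V0; apply: FV.
- move=> i a c io aF cE; apply/FP; split; last by do 4 right; exists i, a.
  by rewrite ((tagged2P _ _ _ _).1 cE); apply: tag2_V0; [apply: V0_omega|apply: FV].
- move=> X [X2 X3 X4 X5 X6]; apply: Fleast => c _ [|[|[|[|]]]].
  + by move=> [t [t' [tT t'T]]]; apply: X2.
  + by move=> [r [n [u [rr rn uT]]]]; apply: X3 rn uT.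
  + by move=> [a [aX]]; apply: X4.
  + by move=> [a [b [aX bX]]]; apply: X5.
  + by move=> [i [a [io aX]]]; apply: X6.
Qed.

Variables F V : M.
Hypothesis F_form : is_form_set N om T F.

(* [sat_clause X c A]: by Tarski's clauses, [A] is the set of assignments
   satisfying [c], provided that [X] relates the immediate subformulas of [c]
   to the sets of assignments satisfying them. *)
Definition sat_clause X c A :=
  (exists t t', tagged2 2 t t' c /\ forall s, is_assignment N om s ->
     (s ∈ A <-> exists d, value V t s d /\ value V t' s d)) \/
  (exists r n u, [/\ pair_in (ar N) r n, tagged2 3 r u c &
     forall s, is_assignment N om s -> (s ∈ A <-> exists y R,
       [/\ tuple_value N V n u s y, pair_in (itp N) r R & y ∈ R])]) \/
  (exists a A1, [/\ pair_in X a A1, tagged 4 a c &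
     forall s, is_assignment N om s -> (s ∈ A <-> ~ s ∈ A1)]) \/
  (exists a b A1 A2, [/\ pair_in X a A1, pair_in X b A2, tagged2 5 a b c &
     forall s, is_assignment N om s -> (s ∈ A <-> s ∈ A1 /\ s ∈ A2)]) \/
  (exists i a A1, [/\ pair_in X a A1, tagged2 6 i a c &
     forall s, is_assignment N om s -> (s ∈ A <-> exists d s',
       [/\ d ∈ D, is_update N om s i d s' & s' ∈ A1])]).

Definition sat_step X p := exists c A, is_pair p c A /\ sat_clause X c A.

Hint Unfold sat_clause sat_step : definability.

(** Negation is not monotone in the truth relation. It becomes so when [X] is a table from formulas
    to their sets of satisfying assignments: a clause looks up the whole set of a subformula, and a
    larger table keeps every successful lookup. *)
Lemma sat_step_mono X Y p : subset_in X Y -> sat_step X p -> sat_step Y p.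
Proof.
move=> XY; have XYp x y : pair_in X x y -> pair_in Y x y.
  by move=> [q [? /XY]]; exists q.
move=> [c [A [pE H]]]; exists c, A; split=> //.
case: H => [|[|[|[|]]]]; first by left.
- by right; left.
- by move=> [a [A1 [/XYp aA cE AE]]]; do 2 right; left; exists a, A1.
- move=> [a [b [A1 [A2 [/XYp aA /XYp bA cE AE]]]]]; do 3 right; left.
  by exists a, b, A1, A2.
- by move=> [i [a [A1 [/XYp aA cE AE]]]]; do 4 right; exists i, a, A1.
Qed.

(** * A fixed point of Tarski's clauses gives each formula exactly one set of assignments *)

Section SatisfactionGraph.
Variable G : M.
Hypothesis GP : forall p, p ∈ G <->
  p ∈ product F (power assignments) /\ sat_step G p.

Lemma sat_graphP c A : pair_in G c A <->
  [/\ c ∈ F, subset_in A assignments & sat_clause G c A].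
Proof.
rewrite pair_inE GP pair_in_product in_power.
split=> [[[cF Asub] [c' [A' [/is_pairP/pair_inj[<- <-]]]]]//|[cF Asub H]].
by split=> //; exists c, A; split=> //; apply/is_pairP.
Qed.

Lemma sat_graph_sub c A s : pair_in G c A -> s ∈ A -> is_assignment N om s.
Proof. by move=> /sat_graphP[_ Asub _] /Asub/in_assignments. Qed.

Lemma sat_graph_eq t t' A : pair_in G (tag2 2 t t') A ->
  forall s, is_assignment N om s ->
    (s ∈ A <-> exists d, value V t s d /\ value V t' s d).
Proof.
move=> /sat_graphP[_ _ [|[|[|[|]]]]].
- by move=> [x [y [/tagged2P/tag2_inj[_ -> ->]]]].
- by move=> [r [n [u [_ /tagged2P/tag_inj[]]]]].
- by move=> [a [A1 [_ /taggedP/tag_inj[]]]].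
- by move=> [a [b [A1 [A2 [_ _ /tagged2P/tag_inj[]]]]]].
- by move=> [i [a [A1 [_ /tagged2P/tag_inj[]]]]].
Qed.

Lemma sat_graph_rel r n u A : pair_in (ar N) r n -> pair_in G (tag2 3 r u) A ->
  forall s, is_assignment N om s -> (s ∈ A <-> exists y R,
    [/\ tuple_value N V n u s y, pair_in (itp N) r R & y ∈ R]).
Proof.
move=> rn /sat_graphP[_ _ [|[|[|[|]]]]].
- by move=> [x [y [/tagged2P/tag_inj[]]]].
- move=> [r' [n' [u' [rn' /tagged2P/tag2_inj[_ rE uE]]]]].
  by subst r' u'; rewrite (arity_unique rn rn').
- by move=> [a [A1 [_ /taggedP/tag_inj[]]]].
- by move=> [a [b [A1 [A2 [_ _ /tagged2P/tag_inj[]]]]]].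
- by move=> [i [a [A1 [_ /tagged2P/tag_inj[]]]]].
Qed.

Lemma sat_graph_not a A : pair_in G (tag 4 a) A -> exists A1,
  pair_in G a A1 /\ forall s, is_assignment N om s -> (s ∈ A <-> ~ s ∈ A1).
Proof.
move=> /sat_graphP[_ _ [|[|[|[|]]]]].
- by move=> [x [y [/tagged2P/tag_inj[]]]].
- by move=> [r [n [u [_ /tagged2P/tag_inj[]]]]].
- by move=> [a' [A1 [aA /taggedP/tag_inj[_ ->]]]]; exists A1.
- by move=> [a' [b [A1 [A2 [_ _ /tagged2P/tag_inj[]]]]]].
- by move=> [i [a' [A1 [_ /tagged2P/tag_inj[]]]]].
Qed.

Lemma sat_graph_and a b A : pair_in G (tag2 5 a b) A -> exists A1 A2,
  [/\ pair_in G a A1, pair_in G b A2 &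
   forall s, is_assignment N om s -> (s ∈ A <-> s ∈ A1 /\ s ∈ A2)].
Proof.
move=> /sat_graphP[_ _ [|[|[|[|]]]]].
- by move=> [x [y [/tagged2P/tag_inj[]]]].
- by move=> [r [n [u [_ /tagged2P/tag_inj[]]]]].
- by move=> [a' [A1 [_ /taggedP/tag_inj[]]]].
- move=> [a' [b' [A1 [A2 [aA bA /tagged2P/tag2_inj[_ -> ->]]]]]].
  by exists A1, A2.
- by move=> [i [a' [A1 [_ /tagged2P/tag_inj[]]]]].
Qed.

Lemma sat_graph_ex i a A : pair_in G (tag2 6 i a) A -> exists A1,
  pair_in G a A1 /\ forall s, is_assignment N om s -> (s ∈ A <-> exists d s',
    [/\ d ∈ D, is_update N om s i d s' & s' ∈ A1]).
Proof.
move=> /sat_graphP[_ _ [|[|[|[|]]]]].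
- by move=> [x [y [/tagged2P/tag_inj[]]]].
- by move=> [r [n [u [_ /tagged2P/tag_inj[]]]]].
- by move=> [a' [A1 [_ /taggedP/tag_inj[]]]].
- by move=> [a' [b [A1 [A2 [_ _ /tagged2P/tag_inj[]]]]]].
- by move=> [i' [a' [A1 [aA /tagged2P/tag2_inj[_ -> ->]]]]]; exists A1.
Qed.

(** The common pattern of the five cases of the induction on formulas: [P] is the condition that
    Tarski's clause prescribes for [c]; one hypothesis gives existence of the set of assignments,
    the other its uniqueness. *)
Lemma sat_graph_intro (P : M -> Prop) c : definable1 P -> c ∈ F ->
  (forall A, (forall s, is_assignment N om s -> (s ∈ A <-> P s)) ->
    sat_clause G c A) ->
  (forall A, pair_in G c A -> forall s, is_assignment N om s -> (s ∈ A <-> P s)) ->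
  exists A, forall A', pair_in G c A' <-> A' = A.
Proof.
move=> dP cF Gc Gu; have [A AP] := separation assignments dP.
have AE s : is_assignment N om s -> (s ∈ A <-> P s).
  by move=> sa; rewrite AP in_assignments; tauto.
exists A => A'; split=> [cA'|->]; last first.
  by apply/sat_graphP; split=> //; [move=> s /AP[]|apply: Gc].
apply: set_ext => s; split=> sA.
  have sa := sat_graph_sub cA' sA; by apply/(AE s sa); apply/(Gu _ cA').
have sa : is_assignment N om s by apply/in_assignments; case/AP: sA.
by apply/(Gu _ cA' s sa); apply/(AE s sa).
Qed.

Lemma sat_graph_total c : c ∈ F -> exists A, forall A', pair_in G c A' <-> A' = A.
Proof.
have [P PP] := @separation M (fun c => exists A : M, forall A', pair_in G c A' <-> A' = A)
  F ltac:(define).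
have [[F2 F3 F4 F5 F6] Fleast] := F_form.
suff PF : form_closed N om T P by move=> /(Fleast _ PF)/PP[].
clear c; split.
- move=> t t' c tT t'T cE; have cF := F2 _ _ _ tT t'T cE; apply/PP; split=> //.
  apply: (sat_graph_intro (P := fun s => exists d, value V t s d /\ value V t' s d));
    first by define.
  + exact: cF.
  + by move=> A AE; left; exists t, t'.
  + by move: cE => /tagged2P ->; apply: sat_graph_eq.
- move=> r n u c rr rn uT cE; have cF := F3 _ _ _ _ rr rn uT cE.
  apply/PP; split=> //.
  apply: (sat_graph_intro (P := fun s => exists y R,
    [/\ tuple_value N V n u s y, pair_in (itp N) r R & y ∈ R])); first by define.
  + exact: cF.
  + by move=> A AE; right; left; exists r, n, u.
  + by move: cE => /tagged2P -> A; apply: sat_graph_rel.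
- move=> a c /PP[aF [A1 A1P]] cE; have cF := F4 _ _ aF cE; apply/PP; split=> //.
  apply: (sat_graph_intro (P := fun s => ~ s ∈ A1)); first by define.
  + exact: cF.
  + by move=> A AE; do 2 right; left; exists a, A1; split=> //; apply/A1P.
  + by move: cE => /taggedP -> A /sat_graph_not[A1' [/A1P ->]].
- move=> a b c /PP[aF [A1 A1P]] /PP[bF [A2 A2P]] cE.
  have cF := F5 _ _ _ aF bF cE; apply/PP; split=> //.
  apply: (sat_graph_intro (P := fun s => s ∈ A1 /\ s ∈ A2)); first by define.
  + exact: cF.
  + move=> A AE; do 3 right; left; exists a, b, A1, A2.
    by split=> //; [apply/A1P|apply/A2P].
  + by move: cE => /tagged2P -> A /sat_graph_and[A1' [A2' [/A1P -> /A2P ->]]].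
- move=> i a c io /PP[aF [A1 A1P]] cE; have cF := F6 _ _ _ io aF cE.
  apply/PP; split=> //.
  apply: (sat_graph_intro (P := fun s => exists d s',
       [/\ d ∈ D, is_update N om s i d s' & s' ∈ A1])); first by define.
  + exact: cF.
  + by move=> A AE; do 4 right; exists i, a, A1; split=> //; apply/A1P.
  + by move: cE => /tagged2P -> A /sat_graph_ex[A1' [/A1P ->]].
Qed.

End SatisfactionGraph.

Lemma satisfaction_exists : exists Tr, is_satisfaction N om T F V Tr.
Proof.
have [|||G [GP _]] := @least_fixpoint M sat_step (product F (power assignments)).
- by define.
- by move=> X; define.
- exact: sat_step_mono.
have [Tr TrP] := @separation M (fun p => exists c s A,
  [/\ is_pair p c s, pair_in G c A & s ∈ A]) (product F assignments) ltac:(define).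
have TrE c s : pair_in Tr c s <-> exists A, pair_in G c A /\ s ∈ A.
  rewrite pair_inE TrP pair_in_product; split.
    by move=> [_ [c' [s' [A [/is_pairP/pair_inj[<- <-]]]]]]; exists A.
  move=> [A [cA sA]]; have /(sat_graphP GP)[cF Asub _] := cA.
  split; first by split=> //; apply: Asub.
  by exists c, s, A; split=> //; apply/is_pairP.
have TrA c A s : pair_in G c A -> pair_in Tr c s <-> s ∈ A.
  move=> cA; rewrite TrE; split=> [[A' [cA' sA']]|]; last by exists A.
  have /(sat_graph_total GP)[B BP] : c ∈ F by case/(sat_graphP GP): cA.
  by move/BP: cA => ->; move/BP: cA' => <-.
have G_total c : c ∈ F -> exists A, pair_in G c A.
  by move=> /(sat_graph_total GP)[A AP]; exists A; apply/AP.
have [[F2 F3 F4 F5 F6] _] := F_form.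
exists Tr => s sa; split.
- move=> t t' c tT t'T cE; have [A cA] := G_total _ (F2 _ _ _ tT t'T cE).
  rewrite (TrA _ _ _ cA); move: cE cA => /tagged2P -> cA.
  exact: (sat_graph_eq GP cA).
- move=> r n u c rr rn uT cE; have [A cA] := G_total _ (F3 _ _ _ _ rr rn uT cE).
  rewrite (TrA _ _ _ cA); move: cE cA => /tagged2P -> cA.
  exact: (sat_graph_rel GP rn cA).
- move=> a c aF cE; have [A cA] := G_total _ (F4 _ _ aF cE).
  rewrite (TrA _ _ _ cA); move: cE cA => /taggedP -> /(sat_graph_not GP)[A1 [aA ->]] //.
  by rewrite (TrA _ _ _ aA).
- move=> a b c aF bF cE; have [A cA] := G_total _ (F5 _ _ _ aF bF cE).
  rewrite (TrA _ _ _ cA); move: cE cA => /tagged2P ->.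
  move=> /(sat_graph_and GP)[A1 [A2 [aA bA ->]]] //.
  by rewrite (TrA _ _ _ aA) (TrA _ _ _ bA).
- move=> i a c io aF cE; have [A cA] := G_total _ (F6 _ _ _ io aF cE).
  rewrite (TrA _ _ _ cA); move: cE cA => /tagged2P ->.
  move=> /(sat_graph_ex GP)[A1 [aA ->]] //.
  by split=> -[d [s' [dD us /(TrA _ _ _ aA)]]]; exists d, s'.
Qed.

End Semantics.

Lemma semantics_exist (M : zfc_model) (N : structure M) : exists T F V Tr : M,
  [/\ is_term_set N (omega M) T, is_form_set N (omega M) T F,
      is_evaluation N (omega M) T V & is_satisfaction N (omega M) T F V Tr].
Proof.
have [V0 [V0b V0p V0f]] := finite_closure (cup (omega M) (cup (rels N) (funs N))).
have Vo : subset_in (omega M) V0 by move=> x xo; apply: V0b; apply/in_cup; left.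
have Vr : subset_in (rels N) V0.
  by move=> x xo; apply: V0b; apply/in_cup; right; apply/in_cup; left.
have Vf : subset_in (funs N) V0.
  by move=> x xo; apply: V0b; apply/in_cup; right; apply/in_cup; right.
have [T [T_term TV]] := term_set_exists Vo Vf V0p V0f.
have [F F_form] := form_set_exists Vo Vr V0p V0f TV.
have [V V_eval] := evaluation_exists T_term.
have [Tr TrP] := satisfaction_exists V F_form.
by exists T, F, V, Tr.
Qed.

(** * Definable sets of assignments, and equivalences of finite index *)

Definition restriction (M : model) (u n t : M) : Prop :=
  forall k x : M, pair_in t k x <-> k ∈ n /\ pair_in u k x.

#[global] Hint Unfold restriction : definability.

Section DefinableSets.
Variables (M : zfc_model) (N : structure M).
Implicit Types x y z a b c f r s p u n A B t i d R X Y h e : M.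

Notation om := (omega M).
Notation D := (dom N).
Notation assignment := (is_assignment N om).

Variables T F V Tr : M.
Hypothesis T_term : is_term_set N om T.
Hypothesis F_form : is_form_set N om T F.
Hypothesis V_eval : is_evaluation N om T V.
Hypothesis Tr_sat : is_satisfaction N om T F V Tr.

(** Parameters are absent: they are the values of variables. Definable subsets of the structure are
    sections of such sets of assignments. *)
Definition dset A := subset_in A (assignments N) /\
  exists a, a ∈ F /\ forall s, assignment s -> (s ∈ A <-> pair_in Tr a s).

Hint Unfold dset : definability.

Lemma dset_assignment A s : dset A -> s ∈ A -> assignment s.
Proof. by move=> [Asub _] /Asub/in_assignments. Qed.

Lemma formula_dset a : a ∈ F ->
  exists A, dset A /\ forall s, s ∈ A <-> assignment s /\ pair_in Tr a s.
Proof.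
move=> aF; have [A AP] := @separation M (pair_in Tr a) (assignments N) ltac:(define).
have AE s : s ∈ A <-> assignment s /\ pair_in Tr a s by rewrite AP in_assignments.
exists A; split=> //; split; first by move=> s /AP[].
by exists a; split=> // s sa; rewrite AE; tauto.
Qed.

Lemma dset_compl A : dset A ->
  exists B, dset B /\ forall s, s ∈ B <-> assignment s /\ ~ s ∈ A.
Proof.
move=> [_ [a [aF aA]]]; have [[_ _ F4 _ _] _] := F_form.
have naF : tag 4 a ∈ F by apply: F4 aF _; apply/taggedP.
have [B [dB BP]] := formula_dset naF; exists B; split=> // s; rewrite BP.
split=> -[sa H]; split=> //; have [_ _ Tr4 _ _] := Tr_sat sa.
  by rewrite (aA s sa); apply/(Tr4 _ _ aF _).1: H; apply/taggedP.
by apply/(Tr4 _ _ aF _); [apply/taggedP|rewrite -(aA s sa)].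
Qed.

Lemma dset_cap A B : dset A -> dset B ->
  exists C, dset C /\ forall s, s ∈ C <-> s ∈ A /\ s ∈ B.
Proof.
move=> dA dB; have [_ [a [aF aA]]] := dA; have [_ [b [bF bB]]] := dB.
have [[_ _ _ F5 _] _] := F_form.
have abF : tag2 5 a b ∈ F by apply: F5 aF bF _; apply/tagged2P.
have [C [dC CP]] := formula_dset abF; exists C; split=> // s; rewrite CP.
split=> [[sa H]|[sA sB]].
  have [_ _ _ Tr5 _] := Tr_sat sa; rewrite (aA s sa) (bB s sa).
  by apply/(Tr5 _ _ _ aF bF _).1: H; apply/tagged2P.
have sa := dset_assignment dA sA; have [_ _ _ Tr5 _] := Tr_sat sa.
by split=> //; apply/(Tr5 _ _ _ aF bF _); [apply/tagged2P|split; [apply/aA|apply/bB]].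
Qed.

Lemma dset_diff A B : dset A -> dset B ->
  exists C, dset C /\ forall s, s ∈ C <-> s ∈ A /\ ~ s ∈ B.
Proof.
move=> dA /dset_compl[B' [dB' B'P]]; have [C [dC CP]] := dset_cap dA dB'.
exists C; split=> // s; rewrite CP B'P; split=> [[sA []]//|[sA sB]].
by split=> //; split=> //; apply: dset_assignment sA.
Qed.

Lemma dset_cup A B : dset A -> dset B ->
  exists C, dset C /\ forall s, s ∈ C <-> s ∈ A \/ s ∈ B.
Proof.
move=> dA dB; have [A' [dA' A'P]] := dset_compl dA.
have [E [dE EP]] := dset_diff dA' dB; have [C [dC CP]] := dset_compl dE.
exists C; split=> // s; rewrite CP EP A'P; split=> [[sa H]|H].
  by apply: contrapT => nH; apply: H; tauto.
have sa : assignment s by case: H => H; [apply: dset_assignment dA H|apply: dset_assignment dB H].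
by split=> //; tauto.
Qed.

Lemma dset_exists i A : i ∈ om -> dset A ->
  exists B, dset B /\ forall s, s ∈ B <-> assignment s /\
    exists d s', [/\ d ∈ D, is_update N om s i d s' & s' ∈ A].
Proof.
move=> io dA; have [_ [a [aF aA]]] := dA; have [[_ _ _ _ F6] _] := F_form.
have iaF : tag2 6 i a ∈ F by apply: F6 io aF _; apply/tagged2P.
have [B [dB BP]] := formula_dset iaF; exists B; split=> // s; rewrite BP.
split=> -[sa H]; split=> //; have [_ _ _ _ Tr6] := Tr_sat sa.
  have /(Tr6 _ _ _ io aF _).1[] := H; first exact/tagged2P.
  move=> d [s' [dD us /aA s'A]]; exists d, s'; split=> //; apply: s'A.
  by case: us.
apply/(Tr6 _ _ _ io aF _); first exact/tagged2P.
move: H => [d [s' [dD us s'A]]]; exists d, s'; split=> //; apply/aA => //.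
by case: us.
Qed.

Lemma variable_term i : i ∈ om -> tag 0 i ∈ T.
Proof. by case: T_term => [[Tv _] _] io; apply: Tv io _; apply/taggedP. Qed.

Lemma variable_value i s d : i ∈ om -> assignment s ->
  value V (tag 0 i) s d <-> pair_in s i d.
Proof. by case: V_eval => Vv _ io sa; apply: Vv io _ sa; apply/taggedP. Qed.

Lemma dset_equation t t' : t ∈ T -> t' ∈ T -> exists A, dset A /\
  forall s, s ∈ A <-> assignment s /\ exists d, value V t s d /\ value V t' s d.
Proof.
move=> tT t'T; have [[F2 _ _ _ _] _] := F_form.
have cF : tag2 2 t t' ∈ F by apply: F2 tT t'T _; apply/tagged2P.
have [A [dA AP]] := formula_dset cF; exists A; split=> // s; rewrite AP.
split=> -[sa H]; split=> //; have [Tr2 _ _ _ _] := Tr_sat sa.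
  by apply/(Tr2 _ _ _ tT t'T _).1: H; apply/tagged2P.
by apply/(Tr2 _ _ _ tT t'T _); first exact/tagged2P.
Qed.

Lemma dset_eq i j : i ∈ om -> j ∈ om -> exists A, dset A /\
  forall s, s ∈ A <-> assignment s /\ exists x, pair_in s i x /\ pair_in s j x.
Proof.
move=> io jo; have [A [dA AP]] :=
  dset_equation (variable_term io) (variable_term jo).
exists A; split=> // s; rewrite AP; split=> -[sa [d [H1 H2]]]; split=> //;
by exists d; split; apply/variable_value.
Qed.

Lemma assignmentP s i x : assignment s ->
  pair_in s i x <-> i ∈ om /\ apply s i = x.
Proof. by move=> sa; apply: (applyP _ _ sa). Qed.

Lemma assignment_value s i : assignment s -> i ∈ om -> exists x,
  x ∈ D /\ pair_in s i x.
Proof.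
move=> sa io; exists (apply s i); split; first exact: apply_in sa io.
exact/assignmentP.
Qed.

Lemma assignment_range s i x : assignment s -> pair_in s i x -> i ∈ om /\ x ∈ D.
Proof.
by move=> sa /(assignmentP _ _ sa)[io <-]; split=> //; apply: apply_in sa io.
Qed.

Lemma update_exists s i d : assignment s -> i ∈ om -> d ∈ D ->
  exists s', is_update N om s i d s'.
Proof.
move=> sa io dD.
have [|||s' [s'a s'P]] := @relation_function M (fun k x =>
  (k = i /\ x = d) \/ (~ k = i /\ pair_in s k x)) om D; first by define.
- move=> k ko; case: (EM (k = i)) => ki; first by exists d; split=> //; left.
  by have [x [xD kx]] := assignment_value sa ko; exists x; split=> //; right.
- move=> k x y ko [[ki ->]|[ki kx]] [[ki' ->]|[ki' ky]] //.
  exact: function_functional sa kx ky.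
exists s'; split=> //.
  by apply/assignmentP => //; split=> //; case: (s'P i io) => [[]|[]].
move=> k x ko ki; rewrite (assignmentP _ _ s'a); case: (s'P k ko) => [[]//|[_ H]].
by split=> [[_ <-]//|kx]; split=> //; apply: function_functional sa H kx.
Qed.

Definition off H s t := forall k x, k ∈ om -> ~ k ∈ H ->
  (pair_in t k x <-> pair_in s k x).

Hint Unfold off : definability.

Lemma off_refl H s : off H s s. Proof. by []. Qed.

Arguments off_refl {H} s.

Lemma off_empty s t : assignment s -> assignment t -> off (emptyset M) s t -> s = t.
Proof.
move=> sa ta st; apply: (function_ext sa ta) => k ko.
suff /(assignmentP _ _ sa)[] : pair_in s k (apply t k) by [].
by apply/st => //; [apply: in_empty | apply/assignmentP].
Qed.

(** [H] may have nonstandard size, so the block of existential quantifiers over the variables in [H]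
    is built one by one in an induction inside [M]. *)
Lemma dset_projection H A : finite H -> subset_in H om -> dset A ->
  exists B, dset B /\ forall s, s ∈ B <-> assignment s /\ exists t,
    t ∈ A /\ off H s t.
Proof.
move=> Hfin Ho dA.
move: H Hfin Ho; apply: finite_ind; first by define.
  move=> _; exists A; split=> // s; split=> [sA|[sa [t [tA st]]]].
    by split; [apply: dset_assignment sA|exists s].
  by rewrite (off_empty sa (dset_assignment dA tA) st).
move=> H i IH Ho.
have io : i ∈ om by apply: Ho; apply/in_adjoin; right.
have [|B [dB BP]] := IH; first by move=> j jH; apply: Ho; apply/in_adjoin; left.
have [C [dC CP]] := dset_exists io dB; exists C; split=> // s; rewrite CP.
split=> [[sa [d [s' [dD [s'a s'i s'P]]]]]|[sa [t [tA st]]]].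
  move=> /BP[_ [t [tA s't]]]; split=> //; exists t; split=> // k x ko kH.
  rewrite (s't k x ko); last by move=> kH'; apply: kH; apply/in_adjoin; left.
  by apply: s'P => // ki; apply: kH; apply/in_adjoin; right.
split=> //; have ta := dset_assignment dA tA.
have [d [dD td]] := assignment_value ta io.
have [s' us] := update_exists sa io dD; have [s'a s'i s'P] := us.
exists d, s'; split=> //; apply/BP; split=> //; exists t; split=> // k x ko kH.
case: (EM (k = i)) => [->|ki]; last first.
  by rewrite (s'P _ _ ko ki); apply: st => // /in_adjoin[].
by split=> [/(function_functional ta td)<-//|/(function_functional s'a s'i)<-].
Qed.

(** * Tuples read off from blocks of variables *)

Variables L m : M.
Hypothesis L_omega : L ∈ om.
Hypothesis m_L : m ∈ L.
Hypothesis arity_L : forall c n, pair_in (ar N) c n -> subset_in n L.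

(* For a function symbol, the entry of [u] at [m] is the value. *)
Definition holds c u :=
  (c ∈ rels N /\ exists n R t, [/\ pair_in (ar N) c n, pair_in (itp N) c R,
     restriction u n t & t ∈ R]) \/
  (c ∈ funs N /\ exists n f t y, [/\ pair_in (ar N) c n, pair_in (itp N) c f,
     restriction u n t, pair_in f t y & pair_in u m y]).

(** The tuple [u] is the composition of [s] after [h], where [h] lists the variables that carry the
    entries. *)
Definition composite h s u := is_function u L D /\ forall k x,
  pair_in u k x <-> exists j, pair_in h k j /\ pair_in s j x.

Hint Unfold holds composite : definability.

Lemma composite_exists h s : is_function h L om -> assignment s ->
  exists u, composite h s u.
Proof.
move=> hf sa.
have [|||u [uf uP]] := @relation_function M (fun k x =>
  exists j, pair_in h k j /\ pair_in s j x) L D; first by define.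
- move=> k kL; have ho := apply_in hf kL; have [x [xD hx]] := assignment_value sa ho.
  by exists x; split=> //; exists (apply h k); split=> //; apply/(applyP _ _ hf).
- move=> k x y kL [j [kj jx]] [j' [kj' j'y]].
  rewrite (function_functional hf kj kj') in jx.
  exact: function_functional sa jx j'y.
exists u; split=> // k x; rewrite (applyP _ _ uf); split=> [[kL <-]|]; first exact: uP.
move=> [j [kj jx]]; have kL := ((applyP _ _ hf).1 kj).1; split=> //.
have [j' [kj' j'x]] := uP k kL; rewrite (function_functional hf kj' kj) in j'x.
exact: function_functional sa j'x jx.
Qed.

Lemma composite_unique h s u u' : composite h s u -> composite h s u' -> u = u'.
Proof.
move=> [uf uP] [u'f u'P]; apply: (function_ext uf u'f) => k kL.
apply: (function_functional uf (x := k)); first exact/(applyP _ _ uf).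
by apply/uP/u'P/(applyP _ _ u'f).
Qed.

Lemma variable_tuple h n : is_function h L om -> subset_in n L ->
  exists e, is_function e n T /\ forall s u y, assignment s -> composite h s u ->
    (tuple_value N V n e s y <-> is_function y n D /\ restriction u n y).
Proof.
move=> hf nL.
have [|||e [ef eP]] := @relation_function M (fun k t =>
  exists j, pair_in h k j /\ tagged 0 j t) n T; first by define.
- move=> k /nL kL; exists (tag 0 (apply h k)); split.
    exact: variable_term (apply_in hf kL).
  by exists (apply h k); split; [apply/(applyP _ _ hf)|apply/taggedP].
- move=> k t t' _ [j [kj /taggedP ->]] [j' [kj' /taggedP ->]].
  by rewrite (function_functional hf kj kj').
have eE k t : pair_in e k t <-> k ∈ n /\ exists j, pair_in h k j /\ tagged 0 j t.
  rewrite (applyP _ _ ef); split=> [[kn <-]|[kn [j [kj /taggedP ->]]]].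
    by split=> //; apply: eP.
  split=> //; have [j' [kj' /taggedP ->]] := eP k kn.
  by rewrite (function_functional hf kj kj').
exists e; split=> // s u y sa [uf uP]; split=> [[yf yv]|[yf yu]]; last first.
  split=> // k t a /eE[kn [j [kj /taggedP ->]]] /yu[_ /uP[j' [kj' j'a]]].
  have [jL jo] : k ∈ L /\ j ∈ om.
    by have [kL <-] := (applyP _ _ hf).1 kj; split=> //; apply: apply_in hf kL.
  by apply/variable_value => //; rewrite (function_functional hf kj kj').
split=> //.
have yE k x : pair_in y k x -> k ∈ n /\ pair_in u k x.
  move=> ykx; have kn := ((applyP _ _ yf).1 ykx).1; split=> //; apply/uP.
  have kL := nL _ kn; exists (apply h k); split; first exact/(applyP _ _ hf).
  apply/variable_value => //; first exact: apply_in hf kL.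
  apply: yv ykx; apply/eE; split=> //; exists (apply h k).
  by split; [apply/(applyP _ _ hf)|apply/taggedP].
move=> k x; split=> [/yE//|[kn ukx]].
have ykk : pair_in y k (apply y k) by apply/(applyP _ _ yf).
by have [_ /(function_functional uf ukx) ->] := yE _ _ ykk.
Qed.

(** The defining formula is atomic: [c] applied to the variables listed by [h], or, for a function
    symbol, the equation of this term with the variable for place [m]. *)
Lemma dset_holds c h : c ∈ rels N \/ c ∈ funs N -> is_function h L om ->
  exists A, dset A /\ forall s, s ∈ A <-> assignment s /\
    exists u, composite h s u /\ holds c u.
Proof.
move=> csym hf; have [n cn] := arity_exists csym.
have [e [ef eP]] := variable_tuple hf (arity_L cn).
have [[_ F3 _ _ _] _] := F_form; have [[_ Tf] _] := T_term.
have symN := @symbols_disjoint _ N c.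
case: csym => [cr|cf].
  have cF : tag2 3 c e ∈ F by apply: F3 cr cn ef _; apply/tagged2P.
  have [A [dA AP]] := formula_dset cF; exists A; split=> // s; rewrite AP.
  split=> -[sa H]; split=> //; have [_ Tr3 _ _ _] := Tr_sat sa.
    have [u us] := composite_exists hf sa; exists u; split=> //.
    have /(Tr3 _ _ _ _ cr cn ef _).1[] := H; first exact/tagged2P.
    move=> y [R [/(eP _ _ _ sa us)[yf uy] cR yR]]; left; split=> //.
    by exists n, R, y.
  move: H => [u [us [[_ [n' [R [t [cn' cR ut tR]]]]]|[cf]]]]; last by case: symN.
  rewrite -(arity_unique cn cn') in ut.
  apply/(Tr3 _ _ _ _ cr cn ef _); first exact/tagged2P.
  exists t, R; split=> //; apply/(eP _ _ _ sa us); split=> //.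
  exact: itp_rel cr cn cR tR.
have tT : tag2 1 c e ∈ T by apply: Tf cf cn ef _; apply/tagged2P.
have hm : apply h m ∈ om := apply_in hf m_L.
have [A [dA AP]] := dset_equation tT (variable_term hm).
have [_ Vf] := V_eval.
exists A; split=> // s; rewrite AP; split=> -[sa H]; split=> //.
  have [u us] := composite_exists hf sa; exists u; split=> //.
  move: H => [d [td /(variable_value _ hm sa) md]]; right; split=> //.
  have /(Vf _ _ _ _ _ _ cf cn ef _ sa).1[] := td; first exact/tagged2P.
  move=> y [g [/(eP _ _ _ sa us)[yf uy] cg yd]]; exists n, g, y, d; split=> //.
  by apply/us.2; exists (apply h m); split=> //; apply/(applyP _ _ hf).
move: H => [u [us [[cr]|[_ [n' [f [t [y [cn' cff ut ty my]]]]]]]]]; first by case: symN.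
rewrite -(arity_unique cn cn') in ut.
exists y; split.
  apply/(Vf _ _ _ _ _ _ cf cn ef _ sa); first exact/tagged2P.
  exists t, f; split=> //; apply/(eP _ _ _ sa us); split=> //.
  exact: (itp_fun_value cf cn cff ty).1.
apply/variable_value => //.
have /us.2[j [mj jy]] := my.
by have [_ ->] := (applyP _ _ hf).1 mj.
Qed.


(** * Agreement over finite families of definable sets *)

Definition agree C s t := forall A, A ∈ C -> (s ∈ A <-> t ∈ A).

Hint Unfold agree : definability.

(* [E] contains an equivalence relation of finite index whose classes are
   definable. *)
Definition good (E : M -> M -> Prop) := exists C,
  [/\ finite C, forall A, A ∈ C -> dset A &
   forall s t, assignment s -> assignment t -> agree C s t -> E s t].

Lemma agree_sub C C' s t : subset_in C C' -> agree C' s t -> agree C s t.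
Proof. by move=> CC st A /CC/st. Qed.

Lemma agree_sym C s t : agree C s t -> agree C t s.
Proof. by move=> st A /st[]. Qed.

Lemma agree_trans C s t u : agree C s t -> agree C t u -> agree C s u.
Proof. by move=> st tu A CA; rewrite (st A CA); apply: tu. Qed.

Lemma good_weaken (E E' : M -> M -> Prop) :
  (forall s t, assignment s -> assignment t -> E s t -> E' s t) ->
  good E -> good E'.
Proof.
move=> EE [C [Cfin Cd CE]]; exists C; split=> // s t sa ta st.
by apply: EE => //; apply: CE.
Qed.

Lemma good_and (E E' : M -> M -> Prop) :
  good E -> good E' -> good (fun s t => E s t /\ E' s t).
Proof.
move=> [C [Cfin Cd CE]] [C' [C'fin C'd C'E]]; exists (cup C C'); split.
- exact: finite_cup.
- by move=> A /in_cup[/Cd|/C'd].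
- move=> s t sa ta st; split; [apply: CE|apply: C'E] => //.
  + by apply: agree_sub st => A CA; apply/in_cup; left.
  + by apply: agree_sub st => A CA; apply/in_cup; right.
Qed.

Lemma good_dset A : dset A -> good (fun s t => s ∈ A <-> t ∈ A).
Proof.
move=> dA; exists (singleton A); split; first exact: finite_singleton.
  by move=> B /in_singleton ->.
by move=> s t _ _; apply; apply/in_singleton.
Qed.

(** [X] may have nonstandard size, so the finite families are united by an induction inside [M]. As
    [E] is an external family, the definability of the induction predicate is the hypothesis
    [dE]. *)
Lemma good_all X (E : M -> M -> M -> Prop) : finite X ->
  definable1 (fun Y => subset_in Y X -> exists C,
    [/\ finite C, forall A, A ∈ C -> dset A &
     forall s t, assignment s -> assignment t -> agree C s t ->
       forall x, x ∈ Y -> E x s t]) ->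
  (forall x, x ∈ X -> good (E x)) ->
  good (fun s t => forall x, x ∈ X -> E x s t).
Proof.
move=> Xfin dE Egood.
(* The predicate of the induction is read off from [dE]; its base and step become the first two
   goals. *)
have [||C [Cfin Cd CE]] := 
  (fun base step => finite_ind dE base step Xfin (fun _ => id)).
- move=> _; exists (emptyset M); split; first exact: finite_empty.
    by move=> A /in_empty.
  by move=> s t _ _ _ x /in_empty.
- move=> Y z IH YX.
  have [|C [Cfin Cd CE]] := IH; first by move=> y yY; apply: YX; apply/in_adjoin; left.
  have [|C' [C'fin C'd C'E]] := Egood z; first by apply: YX; apply/in_adjoin; right.
  exists (cup C C'); split; first exact: finite_cup.
    by move=> A /in_cup[/Cd|/C'd].
  move=> s t sa ta st x /in_adjoin[xY|->].
    by apply: CE xY => //; apply: agree_sub st => A CA; apply/in_cup; left.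
  by apply: C'E => //; apply: agree_sub st => A CA; apply/in_cup; right.
- by exists C; split.
Qed.

(** Equal patterns of equalities: this is what makes sending the value of [s] at [i] to that of [t]
    at [i], for [i] below [n], a well-defined injection. *)
Definition eqpat n s t := forall i, i ∈ n -> forall j, j ∈ n ->
  ((exists x, pair_in s i x /\ pair_in s j x) <->
   (exists x, pair_in t i x /\ pair_in t j x)).

Lemma good_eqpat n : n ∈ om -> good (eqpat n).
Proof.
move=> no; apply: good_all; first exact: finite_omega.
  by define.
move=> i i_n; apply: good_all; first exact: finite_omega.
  by define.
move=> j jn; have [A [dA AP]] := dset_eq (omega_trans no i_n) (omega_trans no jn).
apply: good_weaken (good_dset dA) => s t sa ta; rewrite !AP; tauto.
Qed.

Definition same_holds h s t := forall c, c ∈ cup (rels N) (funs N) ->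
  ((exists u, composite h s u /\ holds c u) <->
   (exists u, composite h t u /\ holds c u)).

Hypothesis N_finite : finite_language N.

Lemma symbols_finite : finite (cup (rels N) (funs N)).
Proof. by case: N_finite => ? ?; apply: finite_cup; apply: is_finite_finite. Qed.

Lemma good_same_holds h : is_function h L om -> good (same_holds h).
Proof.
move=> hf; apply: good_all; first exact: symbols_finite.
  by define.
move=> c /in_cup csym; have [A [dA AP]] := dset_holds csym hf.
apply: good_weaken (good_dset dA) => s t sa ta; rewrite !AP; tauto.
Qed.

(* The induction on [C] needs the answer [t'] to lie in a prescribed set [X]:
   adding [B] to [C] replaces [X] by its intersections with [B] and with the
   complement of [B]. *)
Lemma agree_response H C : finite H -> subset_in H om -> finite C ->
  (forall A, A ∈ C -> dset A) -> forall X, dset X -> exists C',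
  [/\ finite C', forall A, A ∈ C' -> dset A &
   forall s s', assignment s -> assignment s' -> agree C' s s' ->
   forall t, off H s t -> t ∈ X ->
   exists t', [/\ off H s' t', t' ∈ X & agree C t t']].
Proof.
move=> Hfin Ho Cfin; move: C Cfin; apply: finite_ind; first by define.
  move=> _ X dX; have [B [dB BP]] := dset_projection Hfin Ho dX.
  exists (singleton B); split; first exact: finite_singleton.
    by move=> A /in_singleton ->.
  move=> s s' sa s'a ss' t st tX.
  have /BP[_ [t' [t'X s't']]] : s' ∈ B.
    by apply/(ss' B); [apply/in_singleton|apply/BP; split=> //; exists t].
  by exists t'; split=> // A /in_empty.
move=> C B IH Cd X dX.
have dB : dset B by apply: Cd; apply/in_adjoin; right.
have {}IH := IH (fun A CA => Cd A ((in_adjoin _ _ _).2 (or_introl CA))).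
have [X1 [dX1 X1P]] := dset_cap dX dB; have [X2 [dX2 X2P]] := dset_diff dX dB.
have [C1 [C1fin C1d C1P]] := IH _ dX1; have [C2 [C2fin C2d C2P]] := IH _ dX2.
exists (cup C1 C2); split; first exact: finite_cup.
  by move=> A /in_cup[/C1d|/C2d].
move=> s s' sa s'a ss' t st tX.
have ss1 : agree C1 s s' by apply: agree_sub ss' => A CA; apply/in_cup; left.
have ss2 : agree C2 s s' by apply: agree_sub ss' => A CA; apply/in_cup; right.
case: (EM (t ∈ B)) => tB.
  have [|t' [s't' /X1P[t'X t'B] tt']] := C1P _ _ sa s'a ss1 t st; first exact/X1P.
  by exists t'; split=> // A /in_adjoin[/tt'|->].
have [|t' [s't' /X2P[t'X t'B] tt']] := C2P _ _ sa s'a ss2 t st; first exact/X2P.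
by exists t'; split=> // A /in_adjoin[/tt'|->].
Qed.

Definition responds H (E : M -> M -> Prop) s s' :=
  forall t, assignment t -> off H s t ->
  exists t', [/\ assignment t', off H s' t' & E t t'].

(** This is the passage from [q] to [q + 1] rounds. The family found by [agree_response] serves both
    players, because agreement is symmetric. *)
Lemma good_responds H (E : M -> M -> Prop) : finite H -> subset_in H om ->
  good E -> good (fun s s' => responds H E s s' /\
    responds H (fun t' t => E t t') s' s).
Proof.
move=> Hfin Ho [C [Cfin Cd CE]].
(* The set of all assignments is defined by the equation of variable 0 with itself. *)
have [X [dX XP]] : exists X, dset X /\ forall s, assignment s -> s ∈ X.
  have [X [dX XP]] := dset_eq (omega0 M) (omega0 M); exists X; split=> // s sa.
  apply/XP; split=> //; have [x [_ x0]] := assignment_value sa (omega0 M).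
  by exists x.
have [C' [C'fin C'd C'P]] := agree_response Hfin Ho Cfin Cd dX.
exists C'; split=> // s s' sa s'a ss'; split=> t ta st.
  have [t' [s't' t'X tt']] := C'P _ _ sa s'a ss' t st (XP t ta).
  by exists t'; split=> //; [apply: dset_assignment t'X|apply: CE => //; apply: dset_assignment t'X].
have [t' [s't' t'X tt']] := C'P _ _ s'a sa (agree_sym ss') t st (XP t ta).
have t'a := dset_assignment dX t'X.
by exists t'; split=> //; apply: CE => //; apply: agree_sym.
Qed.

(** Classes need not be counted: a set [B] added to [C] cuts [X] and [Y] in two, and each half of
    [Y] is saturated in its half of [X] for the smaller family. When [C] is empty, [Y] is empty or
    equal to [X]. *)
Lemma dset_saturated C : finite C -> (forall A, A ∈ C -> dset A) ->
  forall X Y, dset X -> subset_in Y X ->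
  (forall s t, s ∈ X -> t ∈ X -> agree C s t -> s ∈ Y -> t ∈ Y) -> dset Y.
Proof.
move=> Cfin; move: C Cfin; apply: finite_ind; first by define.
  move=> _ X Y dX YX Ysat; case: (EM (exists s, s ∈ Y)) => [[s sY]|no].
    suff -> : Y = X by [].
    apply: set_ext => t; split=> [/YX//|tX].
    by apply: (Ysat s t) => //; [apply: YX|move=> A /in_empty].
  have [Z [dZ ZP]] := dset_diff dX dX; suff -> : Y = Z by [].
  by apply: set_ext => t; split=> [tY|/ZP[]//]; case: no; exists t.
move=> C B IH Cd X Y dX YX Ysat.
have dB : dset B by apply: Cd; apply/in_adjoin; right.
have {}IH := IH (fun A CA => Cd A ((in_adjoin _ _ _).2 (or_introl CA))).
have [X1 [dX1 X1P]] := dset_cap dX dB; have [X2 [dX2 X2P]] := dset_diff dX dB.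
have [Y1 Y1P] := @separation M (fun s => s ∈ B) Y ltac:(define).
have [Y2 Y2P] := @separation M (fun s => ~ s ∈ B) Y ltac:(define).
have dY1 : dset Y1.
  apply: IH dX1 _ _ => [s /Y1P[/YX sX sB]|s t /X1P[sX sB] /X1P[tX tB] st /Y1P[sY _]].
    exact/X1P.
  apply/Y1P; split=> //; apply: Ysat sY => // A /in_adjoin[/st|->] //.
have dY2 : dset Y2.
  apply: IH dX2 _ _ => [s /Y2P[/YX sX sB]|s t /X2P[sX sB] /X2P[tX tB] st /Y2P[sY _]].
    exact/X2P.
  apply/Y2P; split=> //; apply: Ysat sY => // A /in_adjoin[/st|->] //.
have [Z [dZ ZP]] := dset_cup dY1 dY2; suff -> : Y = Z by [].
apply: set_ext => s; rewrite ZP Y1P Y2P.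
by split=> [sY|[[]|[]]//]; case: (EM (s ∈ B)); [left|right].
Qed.

(** The assignments that agree over [C] with an update of [s] by an element of [S] form a saturated
    set, hence a definable one. Its section at [s] in variable 0 contains [S], and by the separation
    hypothesis nothing else. *)
Lemma good_definable (E : M -> M -> Prop) S s : good E -> subset_in S D ->
  assignment s ->
  (forall a b sa sb, a ∈ S -> b ∈ D -> is_update N om s (emptyset M) a sa ->
     is_update N om s (emptyset M) b sb -> E sa sb -> b ∈ S) ->
  definable N S.
Proof.
move=> [C [Cfin Cd CE]] SD s_a sep.
have [X [dX XP]] : exists X, dset X /\ forall s, s ∈ X <-> assignment s.
  have [X [dX XP]] := dset_eq (omega0 M) (omega0 M); exists X; split=> // t.
  rewrite XP; split=> [[]//|ta]; split=> //.
  by have [x [_ x0]] := assignment_value ta (omega0 M); exists x.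
have [Y YP] := @separation M (fun t => exists a sa, [/\ a ∈ S,
  is_update N om s (emptyset M) a sa & agree C sa t]) X ltac:(define).
have dY : dset Y.
  apply: (dset_saturated Cfin Cd dX) => [t /YP[]//|t t' tX t'X tt' /YP[_]].
  move=> [a [sa [aS us sat]]]; apply/YP; split=> //; exists a, sa; split=> //.
  exact: agree_trans sat tt'.
have [_ [c [cF cY]]] := dY.
exists om, T, F, V, Tr; split; first by split=> //; apply: omegaP.
exists (emptyset M), c, s; split=> //; first exact/is_emptyP.
move=> x xD; split=> [xS|[s' [us' cs']]].
  have [s' us] := update_exists s_a (omega0 M) xD; have [s'a _ _] := us.
  exists s'; split=> //; apply/cY => //; apply/YP; split; first exact/XP.
  by exists x, s'; split.
have [s'a _ _] := us'; move/(cY _ s'a): cs' => /YP[_ [a [sa [aS us sat]]]].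
apply: (sep _ _ _ _ aS xD us us'); apply: CE sat => //; by case: us.
Qed.

Lemma block_exists n : n ∈ om -> exists n' h H,
  [/\ n' ∈ om /\ subset_in n n', is_function h L om,
      forall k k' j, pair_in h k j -> pair_in h k' j -> k = k',
      finite H /\ (forall j, j ∈ H <-> exists k, pair_in h k j) &
      forall j, j ∈ H -> [/\ j ∈ om, j ∈ n' & ~ j ∈ n]].
Proof.
move=> no.
suff [n' [h [[n'o nn'] [hf [hinj hn]]]]] : exists n' h : M,
    (n' ∈ om /\ subset_in n n') /\ (is_function h L om /\
    ((forall k k' j, pair_in h k j -> pair_in h k' j -> k = k') /\
    forall k j, pair_in h k j -> j ∈ n' /\ ~ j ∈ n)).
  have [H HP] := @separation M (fun j => exists k, pair_in h k j) om ltac:(define).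
  have hom k j : pair_in h k j -> k ∈ L /\ j ∈ om.
    by move=> /(applyP _ _ hf)[kL <-]; split=> //; apply: apply_in hf kL.
  exists n', h, H; split=> //; first split.
  - apply: (finite_image (r := h)) (finite_omega L_omega) _.
      by move=> *; apply: function_functional hf _ _; eassumption.
    by move=> j /HP[_ [k kj]]; exists k; split=> //; case: (hom _ _ kj).
  - move=> j; rewrite HP; split=> [[]//|[k kj]]; split; last by exists k.
    by case: (hom _ _ kj).
  - by move=> j /HP[jo [k /hn[]]].
move: L L_omega; apply: omega_ind; first by define.
  exists n, (emptyset M); split; first by split.
  split; last first.
    by split=> [k k' j /pair_inE/in_empty|k j /pair_inE/in_empty].
  by split=> [p /in_empty|x /in_empty].
move=> l lo [n' [h [[n'o nn'] [hf [hinj hn]]]]].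
have hE k j : pair_in (adjoin h (pair l n')) k j <-> pair_in h k j \/ k = l /\ j = n'.
  rewrite !pair_inE in_adjoin; split=> [[|/pair_inj]|[|[-> ->]]]; auto.
have hl k j : pair_in h k j -> k ∈ l by move=> /(applyP _ _ hf)[].
exists (succ n'), (adjoin h (pair l n')); split.
  by split; [apply: omegaS|move=> j /nn' jn; apply/in_succ; left].
split; last first.
  split=> [k k' j /hE[kj|[-> ->]] /hE[k'j|[-> jE]]|k j /hE[/hn[jn' jn]|[_ ->]]] //.
  - exact: hinj kj k'j.
  - by rewrite jE in kj; have [/in_irrefl] := hn _ _ kj.
  - by have [/in_irrefl] := hn _ _ k'j.
  - by split=> //; apply/in_succ; left.
  - split; first by apply/in_succ; right.
    by move=> /nn'/in_irrefl.
split=> [p /in_adjoin[ph|->]|k /in_succ[kl|->]].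
- have [/(_ p ph)[x [y [xl yo pE]]] _] := hf; exists x, y; split=> //.
  by apply/in_succ; left.
- exists l, n'; split=> //; first by apply/in_succ; right.
  exact/is_pairP.
- exists (apply h k); split; first by apply/hE; left; apply/(applyP _ _ hf).
  move=> j /hE[/(applyP _ _ hf)[]//|[kE _]].
  by rewrite kE in kl; case: (in_irrefl kl).
- exists n'; split; first by apply/hE; right.
  by move=> j /hE[/hl/in_irrefl//|[_ ->]].
Qed.

End DefinableSets.

(** * The back-and-forth game *)

Section Moves.
Variable M : model.
Implicit Types g u m : M.

(** This and the following conditions are stated for an arbitrary [model], because they are also
    read in the ultrapower, where transfer replaces the axioms of set theory. *)
Definition injection_in (D g : M) : Prop :=
  forall x y : M, pair_in g x y -> [/\ x ∈ D, y ∈ D &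
    forall x' y' : M, pair_in g x' y' -> (x = x' <-> y = y')].

Definition extends (g g' : M) : Prop :=
  forall x y : M, pair_in g x y -> pair_in g' x y.

Definition corresponds (g u u' : M) : Prop :=
  (forall k x : M, pair_in u k x -> exists x' : M, pair_in u' k x' /\ pair_in g x x') /\
  (forall k x' : M, pair_in u' k x' -> exists x : M, pair_in u k x /\ pair_in g x x').

Definition preserves_rels (rels ar itp u u' : M) : Prop :=
  forall c n R t : M, c ∈ rels -> pair_in ar c n -> pair_in itp c R -> t ∈ R ->
    restriction u n t -> exists t' : M, t' ∈ R /\ restriction u' n t'.

Definition preserves_funs (funs ar itp m u u' : M) : Prop :=
  forall c n f t y : M, c ∈ funs -> pair_in ar c n -> pair_in itp c f ->
    pair_in f t y -> restriction u n t -> pair_in u m y ->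
    exists t' y' : M, [/\ pair_in f t' y', restriction u' n t' & pair_in u' m y'].

(* The partial injection [g] of a game played on the structure grows to [g'],
   which matches the tuples [u] and [u'] of a set [A] of tuples. Tuples carry an
   extra entry, at [m], that stands for the value of a function symbol. *)
Definition game_move (D rels funs ar itp A m g g' u u' : M) : Prop :=
  [/\ [/\ extends g g', injection_in D g', u ∈ A & u' ∈ A], corresponds g' u u',
     preserves_rels rels ar itp u u' /\ preserves_rels rels ar itp u' u &
     preserves_funs funs ar itp m u u' /\ preserves_funs funs ar itp m u' u].

End Moves.

#[global] Hint Unfold injection_in extends corresponds preserves_rels
  preserves_funs game_move : definability.

Section Game.
Variables (M : zfc_model) (N : structure M).
Implicit Types x y z a b c f r s p u n A B t i d R X Y h g : M.

Notation om := (omega M).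
Notation D := (dom N).
Notation assignment := (is_assignment N om).

Variables T F V Tr : M.
Hypothesis T_term : is_term_set N om T.
Hypothesis F_form : is_form_set N om T F.
Hypothesis V_eval : is_evaluation N om T V.
Hypothesis Tr_sat : is_satisfaction N om T F V Tr.
Hypothesis N_finite : finite_language N.

Variable m : M.
Hypothesis m_omega : m ∈ om.
Hypothesis arity_m : forall c n, pair_in (ar N) c n -> subset_in n m.

Notation L := (succ m).

Lemma L_omega : L ∈ om. Proof. exact: omegaS. Qed.

Lemma m_L : m ∈ L. Proof. by apply/in_succ; right. Qed.

Lemma arity_L c n : pair_in (ar N) c n -> subset_in n L.
Proof. by move=> cn k /(arity_m cn) km; apply/in_succ; left. Qed.

Definition tuples : M := pick (fun A => forall u, u ∈ A <-> is_function u L D).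

Lemma in_tuples u : u ∈ tuples <-> is_function u L D.
Proof.
move: u; apply: (@pickP M (fun A => forall u, u ∈ A <-> _)).
have [A AP] := @separation M (fun u => is_function u L D) (power (product L D))
  ltac:(define).
exists A => u; rewrite AP; split=> [[]//|uf]; split=> //; apply/in_power => p pu.
have [/(_ p pu)[x [y [xL yD /is_pairP ->]]] _] := uf.
exact/pair_in_product.
Qed.

Record block := Block { bound : M; index : M; fresh : M }.

Definition is_block n (b : block) :=
  [/\ bound b ∈ om /\ subset_in n (bound b), is_function (index b) L om,
      forall k k' j, pair_in (index b) k j -> pair_in (index b) k' j -> k = k',
      finite (fresh b) /\ (forall j, j ∈ fresh b <-> exists k, pair_in (index b) k j) &
      forall j, j ∈ fresh b -> [/\ j ∈ om, j ∈ bound b & ~ j ∈ n]].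

Lemma exists_block n : exists b : block, n ∈ om -> is_block n b.
Proof.
case: (EM (n ∈ om)) => [no|]; last by exists (Block m m m).
by have [n' [h [H ?]]] := block_exists L_omega no; exists (Block n' h H).
Qed.

(** Blocks are chosen outside [M]. This is harmless: [q] is standard, so a game mentions finitely
    many blocks, and [good] asks for no uniformity in [n]. *)
Definition next n : block := projT1 (cid (exists_block n)).

Lemma nextP n : n ∈ om -> is_block n (next n).
Proof. by rewrite /next; case: cid. Qed.

(* [q] rounds remain and the variables below [n] are in use. In each round one
   player picks a tuple, which becomes the values of a fresh block of variables,
   and the other answers with a tuple satisfying the same symbols. *)
Fixpoint game q n s s' : Prop :=
  if q is q'.+1 then
    let E t t' := same_holds N L m (index (next n)) t t' /\
                  game q' (bound (next n)) t t' in
    responds N (fresh (next n)) E s s' /\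
    responds N (fresh (next n)) (fun t' t => E t t') s' s
  else eqpat n s s'.

Lemma good_game q n : n ∈ om -> good N F Tr (game q n).
Proof.
elim: q n => [|q IH] n no /=; first exact: good_eqpat T_term F_form V_eval Tr_sat _ no.
have [[n'o nn'] hf _ [Hfin _] Hfresh] := nextP no.
apply: (good_responds T_term F_form V_eval Tr_sat) => //.
  by move=> j /Hfresh[].
apply: good_and; last exact: IH.
by apply: (good_same_holds T_term F_form V_eval Tr_sat m_L arity_L).
Qed.

(** A player may leave [s] unchanged, and the answer then differs from [s'] only at fresh variables.
    So the pattern after the remaining rounds restricts to the variables already in use. *)
Lemma game_eqpat q n s s' : n ∈ om -> assignment s -> assignment s' ->
  game q n s s' -> eqpat n s s'.
Proof.
elim: q n s s' => [//|q IH] n s s' no sa s'a /= [sr _].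
have [[n'o nn'] hf _ [Hfin _] Hfresh] := nextP no.
have [t' [t'a s't' [_ /(IH _ _ _ n'o sa t'a) E]]] := sr s sa (off_refl s).
have st i x : i ∈ n -> (pair_in t' i x <-> pair_in s' i x).
  move=> i_n; apply: s't'; first exact: omega_trans no i_n.
  by move=> /Hfresh[].
move=> i i_n j jn; rewrite (E i (nn' _ i_n) j (nn' _ jn)).
by split=> -[x [/(st _ _ i_n) ix /(st _ _ jn) jx]]; exists x.
Qed.

Definition represents g n s s' := forall x y,
  pair_in g x y <-> exists j, [/\ j ∈ n, pair_in s j x & pair_in s' j y].

Lemma represent n s s' : n ∈ om -> assignment s -> assignment s' ->
  exists g, represents g n s s'.
Proof.
move=> no sa s'a; have [g gP] := @separation M (fun p => exists x y j,
  is_pair p x y /\ [/\ j ∈ n, pair_in s j x & pair_in s' j y]) (product D D)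
  ltac:(define).
exists g => x y; rewrite pair_inE gP pair_in_product; split.
  by move=> [_ [x' [y' [j [/is_pairP/pair_inj[<- <-]]]]]]; exists j.
move=> [j [jn sj s'j]]; split; last by exists x, y, j; split=> //; apply/is_pairP.
by have [_ xD] := assignment_range sa sj; have [_ yD] := assignment_range s'a s'j.
Qed.

(** The assignments are hidden, as only the partial map [g] is carried into the ultrapower. No
    definability of this predicate is needed: what is transferred is the legality of each move. *)
Definition position q g := exists n s s',
  [/\ n ∈ om, assignment s, assignment s', game q n s s' & represents g n s s'].

Lemma represents_injection g n s s' : n ∈ om -> assignment s -> assignment s' ->
  eqpat n s s' -> represents g n s s' -> injection_in D g.
Proof.
move=> no sa s'a E gP x y /gP[j [jn sj s'j]].
have [_ xD] := assignment_range sa sj; have [_ yD] := assignment_range s'a s'j.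
split=> // x' y' /gP[j' [j'n sj' s'j']]; split=> [xx'|yy'].
  have [|z [s'jz s'j'z]] := (E j jn j' j'n).1; first by exists x; rewrite {2}xx'.
  by rewrite (function_functional s'a s'j s'jz) (function_functional s'a s'j' s'j'z).
have [|z [sjz sj'z]] := (E j jn j' j'n).2; first by exists y; rewrite {2}yy'.
by rewrite (function_functional sa sj sjz) (function_functional sa sj' sj'z).
Qed.

Lemma position_injection q g : position q g -> injection_in D g.
Proof.
move=> [n [s [s' [no sa s'a gm gP]]]].
by apply: represents_injection gP => //; apply: game_eqpat gm.
Qed.

Lemma overwrite n s v : n ∈ om -> assignment s -> is_function v L D ->
  exists t, [/\ assignment t, off (fresh (next n)) s t &
    composite N L (index (next n)) t v].
Proof.
move=> no sa vf; have [[n'o nn'] hf hinj [Hfin HP] Hfresh] := nextP no.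
set h := index _ in hf hinj HP *; set H := fresh _ in HP Hfin Hfresh *.
have [|||t [ta tP]] := @relation_function M (fun j x =>
  (exists k, pair_in h k j /\ pair_in v k x) \/ (~ j ∈ H /\ pair_in s j x)) om D;
  first by define.
- move=> j jo; case: (EM (j ∈ H)) => [/HP[k kj]|jH]; last first.
    by have [x [xD jx]] := assignment_value sa jo; exists x; split=> //; right.
  have kL := ((applyP _ _ hf).1 kj).1.
  exists (apply v k); split; first exact: apply_in vf kL.
  by left; exists k; split=> //; apply/(applyP _ _ vf).
- have hH k j : pair_in h k j -> j ∈ H by move=> kj; apply/HP; exists k.
  move=> j x y jo [[k [kj kx]]|[jH jx]] [[k' [k'j k'y]]|[jH' jy]].
  + by rewrite (hinj _ _ _ k'j kj) in k'y; apply: function_functional vf kx k'y.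
  + by case: jH'; apply: hH kj.
  + by case: jH; apply: hH k'j.
  + exact: function_functional sa jx jy.
exists t; split=> //.
  move=> j x jo jH; rewrite (assignmentP _ _ ta); case: (tP j jo) => [[k [kj _]]|[_ sj]].
    by case: jH; apply/HP; exists k.
  by split=> [[_ <-]//|jx]; split=> //; apply: function_functional sa sj jx.
have ht k j x : pair_in h k j -> pair_in v k x <-> pair_in t j x.
  move=> kj; have jo : j ∈ om by have [kL <-] := (applyP _ _ hf).1 kj; apply: apply_in hf kL.
  rewrite (assignmentP _ _ ta); case: (tP j jo) => [[k' [k'j k'x]]|[jH _]]; last first.
    by case: jH; apply/HP; exists k.
  rewrite -(hinj _ _ _ k'j kj); split=> [kx|[_ <-]//]; split=> //.
  exact: function_functional vf k'x kx.
split=> // k x; split=> [kx|[j [kj /(ht _ _ _ kj)]]//].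
have kL := ((applyP _ _ vf).1 kx).1.
have kj : pair_in h k (apply h k) by apply/(applyP _ _ hf).
by exists (apply h k); split=> //; apply/(ht _ _ _ kj).
Qed.

Lemma holds_preserves_rels u u' :
  (forall c, c ∈ cup (rels N) (funs N) -> holds N m c u -> holds N m c u') ->
  preserves_rels (rels N) (ar N) (itp N) u u'.
Proof.
move=> uu' c n R t cr cn cR tR ut.
case: (uu' c); first by apply/in_cup; left.
- by left; split=> //; exists n, R, t.
- move=> [_ [n' [R' [t' [cn' cR' ut' t'R]]]]]; exists t'.
  by rewrite (arity_unique cn cn') (itp_unique cR cR').
- by move=> [cf]; case: (@symbols_disjoint _ N c).
Qed.

Lemma holds_preserves_funs u u' :
  (forall c, c ∈ cup (rels N) (funs N) -> holds N m c u -> holds N m c u') ->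
  preserves_funs (funs N) (ar N) (itp N) m u u'.
Proof.
move=> uu' c n f t y cf cn cff ty ut uy.
case: (uu' c); first by apply/in_cup; right.
- by right; split=> //; exists n, f, t, y.
- by move=> [cr]; case: (@symbols_disjoint _ N c).
- move=> [_ [n' [f' [t' [y' [cn' cf' ut' ty' my']]]]]]; exists t', y'.
  by rewrite (arity_unique cn cn') (itp_unique cff cf').
Qed.

Lemma response_move q n g s s' t t' u u' : n ∈ om ->
  represents g n s s' -> assignment t -> assignment t' ->
  off (fresh (next n)) s t -> off (fresh (next n)) s' t' ->
  same_holds N L m (index (next n)) t t' -> game q (bound (next n)) t t' ->
  composite N L (index (next n)) t u -> composite N L (index (next n)) t' u' ->
  exists g', position q g' /\
    game_move D (rels N) (funs N) (ar N) (itp N) tuples m g g' u u'.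
Proof.
move=> no gP ta t'a st s't' tt' gm tu t'u'.
have [[n'o nn'] hf hinj [Hfin HP] Hfresh] := nextP no.
have [g' g'P] := represent n'o ta t'a; exists g'; split.
  by exists (bound (next n)), t, t'.
have holdsE c : c ∈ cup (rels N) (funs N) -> holds N m c u <-> holds N m c u'.
  move=> /tt'[H1 H2]; split=> H.
    have [|v [t'v ?]] := H1; first by exists u.
    by rewrite (composite_unique t'u' t'v).
  have [|v [tv ?]] := H2; first by exists u'.
  by rewrite (composite_unique tu tv).
have hH k j : pair_in (index (next n)) k j -> j ∈ bound (next n) /\ j ∈ om.
  by move=> kj; have [] : [/\ j ∈ om, j ∈ bound (next n) & ~ j ∈ n]
    by apply: Hfresh; apply/HP; exists k.
split; first split.
- move=> x y /gP[j [jn sj s'j]]; apply/g'P; exists j.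
  have jo := omega_trans no jn; have jH : ~ j ∈ fresh (next n) by move=> /Hfresh[].
  by split; [apply: nn'|apply/st|apply/s't'].
- by apply: represents_injection g'P => //; apply: game_eqpat gm.
- by apply/in_tuples; case: tu.
- by apply/in_tuples; case: t'u'.
- split=> k x.
    move=> /tu.2[j [kj jx]]; have [jn' jo] := hH _ _ kj.
    have [x' [_ jx']] := assignment_value t'a jo; exists x'.
    by split; [apply/t'u'.2; exists j|apply/g'P; exists j].
  move=> /t'u'.2[j [kj jx]]; have [jn' jo] := hH _ _ kj.
  have [x' [_ jx']] := assignment_value ta jo; exists x'.
  by split; [apply/tu.2; exists j|apply/g'P; exists j].
- by split; apply: holds_preserves_rels => c /holdsE[].
- by split; apply: holds_preserves_funs => c /holdsE[].
Qed.

Lemma position_forth q g v : position q.+1 g -> exists g' u u',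
  [/\ position q g', game_move D (rels N) (funs N) (ar N) (itp N) tuples m g g' u u' &
      v ∈ tuples -> u = v].
Proof.
move=> [n [s [s' [no sa s'a [sr _] gP]]]].
have [_ hf _ _ _] := nextP no.
have [t [ta st tv]] : exists t, [/\ assignment t, off (fresh (next n)) s t &
    v ∈ tuples -> composite N L (index (next n)) t v].
  case: (EM (v ∈ tuples)) => [/in_tuples/(overwrite no sa)[t [ta st tv]]|vt].
    by exists t.
  (* If [v] is not a tuple, the round is played with the assignment left as it is. *)
  by exists s; split.
have [t' [t'a s't' [tt' gm]]] := sr t ta st.
have [u tu] := composite_exists hf ta; have [u' t'u'] := composite_exists hf t'a.
have [g' [g'pos g'm]] := response_move no gP ta t'a st s't' tt' gm tu t'u'.
by exists g', u, u'; split=> // /tv; apply: composite_unique.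
Qed.

Lemma position_back q g v : position q.+1 g -> exists g' u u',
  [/\ position q g', game_move D (rels N) (funs N) (ar N) (itp N) tuples m g g' u u' &
      v ∈ tuples -> u' = v].
Proof.
move=> [n [s [s' [no sa s'a [_ sr] gP]]]].
have [_ hf _ _ _] := nextP no.
have [t' [t'a s't' t'v]] : exists t, [/\ assignment t, off (fresh (next n)) s' t &
    v ∈ tuples -> composite N L (index (next n)) t v].
  case: (EM (v ∈ tuples)) => [/in_tuples/(overwrite no s'a)[t [ta st tv]]|vt].
    by exists t.
  by exists s'; split.
have [t [ta st [tt' gm]]] := sr t' t'a s't'.
have [u tu] := composite_exists hf ta; have [u' t'u'] := composite_exists hf t'a.
have [g' [g'pos g'm]] := response_move no gP ta t'a st s't' tt' gm tu t'u'.
by exists g', u, u'; split=> // /t'v; apply: composite_unique.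
Qed.

(** Variable 0 is kept apart from those that list [X]: it will receive an element of [S] on one side
    and one outside [S] on the other. *)
Lemma enumerate X : finite X -> exists n s, [/\ n ∈ om, emptyset M ∈ n,
  assignment s & forall x, x ∈ X -> x ∈ D ->
    exists j, [/\ j ∈ n, ~ j = emptyset M & pair_in s j x]].
Proof.
have [d dD] := dom_nonempty N.
move: X; apply: finite_ind; first by define.
  have [|||s [sa _]] := @relation_function M (fun _ x => x = d) om D; first by define.
  - by move=> j _; exists d.
  - by move=> j x y _ -> ->.
  exists (succ (emptyset M)), s; split=> //; first exact: omegaS (omega0 M).
  - by apply/in_succ; right.
  - by move=> x /in_empty.
move=> X z [n [s [no n0 sa sP]]].
case: (EM (z ∈ D)) => zD; last first.
  by exists n, s; split=> // x /in_adjoin[/sP//|-> /zD].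
have [s' [s'a s'n s'P]] := update_exists sa no zD.
exists (succ n), s'; split=> //; [exact: omegaS|by apply/in_succ; left|].
move=> x /in_adjoin[xX|->] xD; last first.
  exists n; split=> //; first by apply/in_succ; right.
  by move=> nE; rewrite nE in n0; case: (in_empty n0).
have [j [jn j0 jx]] := sP x xX xD; exists j; split=> //; first by apply/in_succ; left.
apply/s'P => //; first exact: omega_trans no jn.
by move=> jE; rewrite jE in jn; case: (in_irrefl jn).
Qed.

(** * Undefinability gives initial positions, and short tuples are padded *)

Variable S : M.
Hypothesis S_subset : subset_in S D.
Hypothesis S_undefinable : ~ definable N S.

Lemma initial_position q X : finite X -> exists g a b,
  [/\ position q g, a ∈ S, b ∈ D /\ ~ b ∈ S, pair_in g a b &
      forall x, x ∈ X -> x ∈ D -> pair_in g x x].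
Proof.
move=> /enumerate[n [s [no n0 sa sP]]].
apply: contrapT => no_position; apply: S_undefinable.
apply: (good_definable T_term F_form V_eval Tr_sat (good_game q no) S_subset sa).
move=> a b s_a s_b aS bD ua ub gm; apply: contrapT => bS; apply: no_position.
have [s_aa a0 aP] := ua; have [s_ba b0 bP] := ub.
have [g gP] := represent no s_aa s_ba.
exists g, a, b; split=> //; first by exists n, s_a, s_b.
  by apply/gP; exists (emptyset M).
move=> x xX xD; have [j [jn j0 jx]] := sP x xX xD; apply/gP; exists j.
have jo := omega_trans no jn.
by split=> //; [apply/aP|apply/bP].
Qed.

(** All places from [n] on are filled with [y]; place [m] is among them, since it lies beyond every
    arity. *)
Lemma extend_tuple n t y : subset_in n m -> is_function t n D -> y ∈ D ->
  exists u, [/\ u ∈ tuples, restriction u n t & pair_in u m y].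
Proof.
move=> nm tf yD.
have [|||u [uf uP]] := @relation_function M (fun k x =>
  pair_in t k x \/ (~ k ∈ n /\ x = y)) L D; first by define.
- move=> k _; case: (EM (k ∈ n)) => kn; last by exists y; split=> //; right.
  exists (apply t k); split; first exact: apply_in tf kn.
  by left; apply/(applyP _ _ tf).
- have tn k x : pair_in t k x -> k ∈ n by move=> /(applyP _ _ tf)[].
  move=> k x x' _ [kx|[kn ->]] [kx'|[kn' ->]] //.
  + exact: function_functional tf kx kx'.
  + by case: kn'; apply: tn kx.
  + by case: kn; apply: tn kx'.
exists u; split; first exact/in_tuples.
  move=> k x; rewrite (applyP _ _ uf); split=> [kx|[kn [kL <-]]]; last first.
    by case: (uP k kL) => [//|[]].
  have kn := ((applyP _ _ tf).1 kx).1.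
  have kL : k ∈ L by apply/in_succ; left; apply: nm.
  split=> //; split=> //; case: (uP k kL) => [kx'|[]//].
  exact: function_functional tf kx' kx.
apply/(applyP _ _ uf); split; first exact: m_L.
case: (uP m m_L) => [/(applyP _ _ tf)[/nm/in_irrefl]|[]] //.
Qed.

End Game.

Lemma arity_bound (M : zfc_model) (N : structure M) : finite_language N ->
  exists m, m ∈ omega M /\ forall c n : M, pair_in (ar N) c n -> subset_in n m.
Proof.
move=> N_finite.
suff: forall X : M, finite X -> exists m, m ∈ omega M /\
    forall c n : M, c ∈ X -> pair_in (ar N) c n -> subset_in n m.
  move=> /(_ _ (symbols_finite N_finite))[m [mo mP]]; exists m; split=> // c n cn.
  by apply: mP (cn); apply/in_cup; case: (arity_symbol cn).
apply: finite_ind; first by define.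
  by exists (emptyset M); split; [apply: omega0|move=> c n /in_empty].
move=> X z [m [mo mP]].
case: (EM (exists n : M, pair_in (ar N) z n)) => [[n zn]|no]; last first.
  exists m; split=> // c n /in_adjoin[/mP|-> zn]; first exact.
  by case: no; exists n.
have [k [ko mk nk]] := omega_max mo (arity_symbol zn).2.
exists k; split=> // c n' /in_adjoin[cX cn|->] i.
  by move=> /(mP _ _ cX cn)/mk.
by rewrite (arity_unique i zn).
Qed.

(** All that the ultrapower argument uses about definability: formulas have disappeared. [W]
    contains the symbols, their arities and the positions of entries, and [A] is the set of tuples
    that can be played. *)
Lemma game_exists (M : zfc_model) (N : structure M) (S : M) :
  finite_language N -> subset_in S (dom N) -> ~ definable N S ->
  exists (W A m : M) (position : nat -> M -> Prop),
  [/\ [/\ finite W, subset_in (rels N) W, subset_in (funs N) W &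
        forall c n : M, pair_in (ar N) c n -> c ∈ W /\ n ∈ W],
      [/\ forall u k x : M, u ∈ A -> pair_in u k x -> k ∈ W /\ x ∈ dom N,
         forall u k x y : M, u ∈ A -> pair_in u k x -> pair_in u k y -> x = y,
         forall x : M, x ∈ dom N -> exists u k : M, u ∈ A /\ pair_in u k x,
         forall c R t : M, c ∈ rels N -> pair_in (itp N) c R -> t ∈ R ->
           exists n u : M, [/\ pair_in (ar N) c n, u ∈ A & restriction u n t] &
         forall c f t y : M, c ∈ funs N -> pair_in (itp N) c f -> pair_in f t y ->
           exists n u : M, [/\ pair_in (ar N) c n, u ∈ A, restriction u n t &
             pair_in u m y]],
      forall q (X : M), finite X -> exists g a b : M,
        [/\ position q g, injection_in (dom N) g,
           [/\ a ∈ S, b ∈ dom N & ~ b ∈ S], pair_in g a b &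
           forall x : M, x ∈ X -> x ∈ dom N -> pair_in g x x],
      forall q (g v : M), position q.+1 g -> exists g' u u' : M,
        [/\ position q g', game_move (dom N) (rels N) (funs N) (ar N) (itp N)
             A m g g' u u' & v ∈ A -> u = v] &
      forall q (g v : M), position q.+1 g -> exists g' u u' : M,
        [/\ position q g', game_move (dom N) (rels N) (funs N) (ar N) (itp N)
             A m g g' u u' & v ∈ A -> u' = v]].
Proof.
move=> N_finite S_subset S_undefinable.
have [T [F [V [Tr [T_term F_form V_eval Tr_sat]]]]] := semantics_exist N.
have [m [mo arity_m]] := arity_bound N_finite.
exists (cup (cup (rels N) (funs N)) (succ m)), (tuples N m), m, (position N mo).
have Lo := L_omega mo.
split.
- split.
  + by apply: finite_cup; [apply: symbols_finite|apply: finite_omega].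
  + by move=> x xr; apply/in_cup; left; apply/in_cup; left.
  + by move=> x xr; apply/in_cup; left; apply/in_cup; right.
  + move=> c n cn; have [csym no] := arity_symbol cn.
    split; apply/in_cup; [left; exact/in_cup|right].
    have nm := arity_m _ _ cn; apply/in_succ.
    by case: (omega_total no mo) => [|->|/nm/in_irrefl]; auto.
- split.
  + move=> u k x /in_tuples uf /(applyP _ _ uf)[kL <-].
    by split; [apply/in_cup; right|apply: apply_in uf kL].
  + by move=> u k x y /in_tuples; apply: function_functional.
  + move=> x xD.
    have [u [uf uP]] : exists u, is_function u (succ m) (dom N) /\
        forall k, k ∈ succ m -> apply u k = x.
      by apply: (@relation_function M (fun _ y => y = x)) => [|k _|k y z _ -> ->];
        [define|exists x|].
    exists u, m; split; first exact/in_tuples.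
    by apply/(applyP _ _ uf); split; [apply: m_L|apply: uP; apply: m_L].
  + move=> c R t cr cR tR; have [n cn] := arity_exists (or_introl cr).
    have [d dD] := dom_nonempty N.
    have [u [uA ut _]] := extend_tuple (arity_m _ _ cn) (itp_rel cr cn cR tR) dD.
    by exists n, u.
  + move=> c f t y cf cff ty; have [n cn] := arity_exists (or_intror cf).
    have [tf yD] := itp_fun_value cf cn cff ty.
    have [u [uA ut uy]] := extend_tuple (arity_m _ _ cn) tf yD.
    by exists n, u.
- move=> q X Xfin.
  have [g [a [b [gpos aS [bD bS] ab gX]]]] := initial_position T_term F_form V_eval
    Tr_sat N_finite mo arity_m S_subset S_undefinable q Xfin.
  by exists g, a, b; split=> //; apply: position_injection gpos.
- by move=> q g v; apply: position_forth.
- by move=> q g v; apply: position_back.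
Qed.

(** * Ultrapowers restricted to countably many sequences *)

(* Only the sequences in [G] are kept; closure of [G] under Skolem functions is
   what Łoś's theorem needs of it. *)
Section RestrictedUltrapower.
Variables (M : model) (c0 : M) (U : set_system nat) (U_ultra : UltraFilter U).
Variable G : set (nat -> M).
Hypothesis G_const : forall x, G (fun=> x).
Hypothesis G_skolem : forall p i (v : nat -> nat -> M), (forall k, G (v k)) ->
  exists w, G w /\ forall n, sat (fun k => v k n) (FEx i p) ->
    sat (upd (fun k => v k n) i (w n)) p.

Lemma ultra_iff (A B : set nat) : U [set n | A n <-> B n] -> U A <-> U B.
Proof.
move=> AB; split=> [UA|UB].
  by apply: filterS2 AB UA => n /= [H _]; apply: H.
by apply: filterS2 AB UB => n /= [_ H]; apply: H.
Qed.

Lemma ultra_not (A : set nat) : ~ U A <-> U (~` A).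
Proof.
split=> [nA|nA UA]; first by case: (in_ultra_setVsetC A U_ultra).
have : U (A `&` ~` A) by apply: filterI.
by rewrite setICr; apply: filter_not_empty.
Qed.

Lemma ultra_and (A B : set nat) : U [set n | A n /\ B n] <-> U A /\ U B.
Proof.
split=> [AB|[UA UB]]; last exact: filterI.
by split; apply: filterS AB => n [].
Qed.

Lemma ultra_prop (P : Prop) : U [set n | P] <-> P.
Proof.
split=> [UP|p]; last exact: filterE.
by have [] := filter_ex UP.
Qed.

Definition ultra_eq (g h : nat -> M) := U [set n | g n = h n].

Definition ultra_carrier :=
  {X : set (nat -> M) | exists2 g, G g & X = ultra_eq g}.

Definition cls (g : nat -> M) : ultra_carrier :=
  match pselect (G g) with
  | left Gg => exist _ (ultra_eq g) (ex_intro2 _ _ g Gg erefl)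
  | right _ => exist _ (ultra_eq (fun=> c0)) (ex_intro2 _ _ _ (G_const c0) erefl)
  end.

Lemma val_cls g : G g -> sval (cls g) = ultra_eq g.
Proof. by rewrite /cls; case: pselect. Qed.

Lemma ultra_carrier_eq (x y : ultra_carrier) : sval x = sval y -> x = y.
Proof.
by case: x y => [X XP] [Y YP] /= E; subst Y; rewrite (Prop_irrelevance XP YP).
Qed.

Lemma cls_eq g h : G g -> G h -> cls g = cls h <-> ultra_eq g h.
Proof.
move=> Gg Gh; split=> [/(congr1 sval)|gh].
  rewrite !val_cls // => E; have : ultra_eq h h by apply: filterE.
  by rewrite -E.
apply: ultra_carrier_eq; rewrite !val_cls //; apply/funext => f; apply/propext.
by split=> gf; apply: filterS2 gh gf => n /= [->].
Qed.

Lemma cls_surj x : exists g, G g /\ x = cls g.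
Proof.
case: x => X XP; have [g Gg Xg] := XP; exists g; split=> //.
by apply: ultra_carrier_eq; rewrite val_cls.
Qed.

Definition ultra : model := Model (fun x y : ultra_carrier =>
  exists g h, [/\ G g, G h, x = cls g, y = cls h & U [set n | g n ∈ h n]]).

Definition class g : ultra := cls g.

Lemma class_eq g h : G g -> G h -> class g = class h <-> U [set n | g n = h n].
Proof. exact: cls_eq. Qed.

Lemma class_surj (x : ultra) : exists g, G g /\ x = class g.
Proof. exact: cls_surj. Qed.

Lemma class_in g h : G g -> G h -> class g ∈ class h <-> U [set n | g n ∈ h n].
Proof.
move=> Gg Gh; split=> [[g' [h' [Gg' Gh' /(cls_eq Gg Gg') gE /(cls_eq Gh Gh') hE UH]]]|H].
  by apply: filterS3 gE hE UH => n /= -> ->.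
by exists g, h.
Qed.

Lemma upd_comp (A B : Type) (f : A -> B) (v : nat -> A) i a :
  f \o upd v i a = upd (f \o v) i (f a).
Proof. by apply/funext => k; rewrite /upd /=; case: eqP. Qed.

Theorem los p (v : nat -> nat -> M) : (forall k, G (v k)) ->
  sat (fun k => class (v k)) p <-> U [set n | sat (fun k => v k n) p].
Proof.
elim: p v => [i j|i j|p IH|p IHp q IHq|i p IH] v Gv.
- exact: class_in.
- exact: class_eq.
- by rewrite /= IH // ultra_not.
- by rewrite /= IHp // IHq // -ultra_and.
have updE w n : (fun k => upd v i w k n) = upd (fun k => v k n) i (w n).
  by rewrite -(upd_comp (fun f : nat -> M => f n)).
have Gupd w : G w -> forall k, G (upd v i w k).
  by move=> Gw k; rewrite /upd; case: eqP.
have IHw w : G w -> sat (upd (fun k => class (v k)) i (class w)) p <->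
    U [set n | sat (upd (fun k => v k n) i (w n)) p].
  move=> Gw; have := IH _ (Gupd w Gw).
  rewrite -(upd_comp class) => ->; apply: ultra_iff; apply: filterE => n /=.
  by rewrite updE.
split=> [[x]|H].
  have [w [Gw ->]] := class_surj x; move=> /(IHw w Gw).
  by apply: filterS => n; exists (w n).
have [w [Gw wP]] := G_skolem p i Gv; exists (class w); apply/IHw => //.
by apply: filterS H => n /wP.
Qed.

Definition diagonal (x : M) : ultra := class (fun=> x).

Lemma diagonal_elementary : elementary diagonal.
Proof.
move=> p v; have := los p (v := fun k _ => v k) (fun k => G_const (v k)).
by move=> ->; rewrite ultra_prop.
Qed.

Definition factor (j : option nat) : model := if j is Some _ then M else ultra.

Definition family (g : nat -> M) (j : option nat) : factor j :=
  match j with Some n => g n | None => class g end.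

Definition coherent (c : forall j, factor j) : Prop := exists g,
  G g /\ forall j, c j = family g j.

Lemma coherent_family g : G g -> coherent (family g).
Proof. by exists g. Qed.

(** Coherent parameters are sequences in [G] together with their classes, so one formula expresses
    [P] in every factor and in the ultrapower, and Łoś's theorem applies to it. *)
Lemma transfer (P : option nat -> Prop) :
  def_pred coherent (fun j _ => P j) ->
  P None <-> U [set n | P (Some n)].
Proof.
move=> [p [e [Ke pe]]].
have [f fP] := @choice _ _ (fun k g => G g /\ forall j, e j k = family g j) Ke.
pose w := interleave (fun _ _ => c0) f.
have Gw k : G (w k) by rewrite /w /interleave; case: (odd k) => //; case: (fP k./2).
have wE j : interleave (fun _ => family (fun=> c0) j) (e j) = fun k => family (w k) j.
  apply/funext => k; rewrite /w /interleave; case: (odd k) => //.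
  by case: (fP k./2).
rewrite -(pe None (fun _ => family (fun=> c0) None)) wE (los p Gw).
apply: ultra_iff; apply: filterE => n.
by have := pe (Some n) (fun _ => family (fun=> c0) (Some n)); rewrite wE.
Qed.

End RestrictedUltrapower.

(** * A countable set of sequences closed under Skolem functions and given operations *)

Section Closure.
Variables (M : model) (c0 : M).
Hypothesis M_countable : countable [set: M].
Variables (I : countType) (op : I -> nat -> seq M -> M).

Definition element (k : nat) : M :=
  let f := sval (cid (elimT (countable_injP _) M_countable)) in
  if pselect (exists x, f x = k) is left e then sval (cid e) else c0.

Lemma element_surj x : exists k, element k = x.
Proof.
rewrite /element; case: cid => f f_inj /=; exists (f x).
case: pselect => [e|[]]; last by exists x.
by case: cid => y /= /f_inj; rewrite !inE; apply.
Qed.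

(** Reduces an assignment to a finite list, so that a Skolem function can be an operation on
    lists. *)
Lemma sat_ext (p : fml) (A : model) : exists b, forall v w : nat -> A,
  (forall k, k < b -> v k = w k) -> sat v p <-> sat w p.
Proof.
elim: p => [i j|i j|p [b IH]|p [b IH] q [b' IH']|i p [b IH]].
- exists (maxn i j).+1 => v w vw /=.
  by rewrite !vw // ltnS ?leq_maxl ?leq_maxr.
- exists (maxn i j).+1 => v w vw /=.
  by rewrite !vw // ltnS ?leq_maxl ?leq_maxr.
- by exists b => v w /IH /= ->.
- exists (maxn b b') => v w vw /=; rewrite (IH v w) ?(IH' v w) // => k kb;
  by apply: vw; rewrite leq_max kb ?orbT.
- exists b => v w vw /=.
  have E a : sat (upd v i a) p <-> sat (upd w i a) p.
    by apply: IH => k /vw kb; rewrite /upd kb.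
  by split=> -[a /E]; exists a.
Qed.

(** Trees over [nat] form a countable type, which supplies codes for formulas. *)
Fixpoint fml_tree (p : fml) : GenTree.tree nat :=
  match p with
  | FMem i j => GenTree.Node 0 [:: GenTree.Leaf i; GenTree.Leaf j]
  | FEq i j => GenTree.Node 1 [:: GenTree.Leaf i; GenTree.Leaf j]
  | FNot q => GenTree.Node 2 [:: fml_tree q]
  | FAnd q r => GenTree.Node 3 [:: fml_tree q; fml_tree r]
  | FEx i q => GenTree.Node 4 [:: GenTree.Leaf i; fml_tree q]
  end.

Lemma fml_tree_inj : injective fml_tree.
Proof.
elim=> [i j|i j|p IH|p IH q IH'|i p IH] [i' j'|i' j'|p'|p' q'|i' p'] //=.
- by move=> [-> ->].
- by move=> [-> ->].
- by move=> [/IH ->].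
- by move=> [/IH -> /IH' ->].
- by move=> [-> /IH ->].
Qed.

Definition skolem (t : GenTree.tree nat) (i : nat) (l : seq M) : M :=
  if pselect (exists a, exists2 p, fml_tree p = t & sat (upd (nth c0 l) i a) p)
  is left e then sval (cid e) else c0.

Definition node (o : nat) (n : nat) (l : seq M) : M :=
  match (unpickle o : option (GenTree.tree nat * nat + I)) with
  | Some (inl (t, i)) => skolem t i l
  | Some (inr x) => op x n l
  | None => c0
  end.

(** Trees serve as closed terms: a leaf names a constant sequence, a node an operation applied in
    each factor. Enumerating the trees enumerates the closure. *)
Fixpoint eval (t : GenTree.tree nat) (n : nat) : M :=
  match t with
  | GenTree.Leaf k => element k
  | GenTree.Node o ts => node o n [seq eval t n | t <- ts]
  end.

Definition generated : set (nat -> M) := range eval.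

Definition sequence (k : nat) : nat -> M :=
  if (unpickle k : option (GenTree.tree nat)) is Some t then eval t else fun=> c0.

Lemma generated_const x : generated (fun=> x).
Proof. by have [k <-] := element_surj x; exists (GenTree.Leaf k). Qed.

Lemma generated_sequence k : generated (sequence k).
Proof.
rewrite /sequence; case: unpickle => [t|]; first by exists t.
exact: generated_const.
Qed.

Lemma sequence_surj g : generated g -> exists k, g = sequence k.
Proof. by move=> [t _ <-]; exists (pickle t); rewrite /sequence pickleK. Qed.

Lemma generated_op x : generated (fun n => op x n [::]).
Proof.
exists (GenTree.Node (pickle (inr x : GenTree.tree nat * nat + I)) [::]) => //.
by apply/funext => n /=; rewrite /node pickleK.
Qed.

Lemma generated_op2 x g h : generated g -> generated h ->
  generated (fun n => op x n [:: g n; h n]).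
Proof.
move=> [t _ <-] [t' _ <-].
exists (GenTree.Node (pickle (inr x : GenTree.tree nat * nat + I)) [:: t; t']) => //.
by apply/funext => n /=; rewrite /node pickleK.
Qed.

Lemma generated_skolem p i (v : nat -> nat -> M) : (forall k, generated (v k)) ->
  exists w, generated w /\ forall n, sat (fun k => v k n) (FEx i p) ->
    sat (upd (fun k => v k n) i (w n)) p.
Proof.
move=> Gv; have [t tv] : exists t : nat -> _, forall k, eval (t k) = v k.
  have Gv' k : exists t, eval t = v k by have [t _ tv] := Gv k; exists t.
  by have [t tv] := choice Gv'; exists t.
have [b bP] := sat_ext p M.
pose o := pickle (inl (fml_tree p, i) : GenTree.tree nat * nat + I).
exists (eval (GenTree.Node o (mkseq t b))); split; first by exists (GenTree.Node o (mkseq t b)).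
move=> n [a ap] /=; rewrite /node pickleK /skolem -map_comp.
set l := map _ _.
have lE k : k < b -> nth c0 l k = v k n.
  by move=> kb; rewrite (nth_map 0) ?size_iota //= nth_iota // tv.
have lP x : sat (upd (nth c0 l) i x) p <-> sat (upd (fun k => v k n) i x) p.
  by apply: bP => k kb; rewrite /upd lE.
case: pselect => [e|[]]; last by exists a, p => //; apply/lP.
by case: cid => x /= [q /fml_tree_inj qp]; rewrite qp => /lP.
Qed.

End Closure.

(** * The two extensions *)

Section TwoExtensions.
Variables (M : zfc_model) (N : structure M) (S W A m : M).
Variable position : nat -> M -> Prop.

Notation D := (dom N).
Notation legal := (game_move D (rels N) (funs N) (ar N) (itp N) A m).

Hypothesis M_countable : countable [set: M].
Hypothesis W_finite : finite W.
Hypothesis rels_W : subset_in (rels N) W.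
Hypothesis funs_W : subset_in (funs N) W.
Hypothesis ar_W : forall c n : M, pair_in (ar N) c n -> c ∈ W /\ n ∈ W.
Hypothesis tuple_entry : forall u k x : M, u ∈ A -> pair_in u k x ->
  k ∈ W /\ x ∈ D.
Hypothesis tuple_functional : forall u k x y : M, u ∈ A -> pair_in u k x ->
  pair_in u k y -> x = y.
Hypothesis entry_tuple : forall x : M, x ∈ D ->
  exists u k : M, u ∈ A /\ pair_in u k x.
Hypothesis rel_tuple : forall c R t : M, c ∈ rels N -> pair_in (itp N) c R ->
  t ∈ R -> exists n u : M, [/\ pair_in (ar N) c n, u ∈ A & restriction u n t].
Hypothesis fun_tuple : forall c f t y : M, c ∈ funs N -> pair_in (itp N) c f ->
  pair_in f t y -> exists n u : M, [/\ pair_in (ar N) c n, u ∈ A,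
    restriction u n t & pair_in u m y].
Hypothesis position_start : forall q (X : M), finite X -> exists g a b : M,
  [/\ position q g, injection_in D g, [/\ a ∈ S, b ∈ D & ~ b ∈ S],
      pair_in g a b & forall x : M, x ∈ X -> x ∈ D -> pair_in g x x].
Hypothesis position_left : forall q (g v : M), position q.+1 g ->
  exists g' u u' : M, [/\ position q g', legal g g' u u' & v ∈ A -> u = v].
Hypothesis position_right : forall q (g v : M), position q.+1 g ->
  exists g' u u' : M, [/\ position q g', legal g g' u u' & v ∈ A -> u' = v].

Notation c0 := (point M).
Notation el := (element c0 M_countable).

(** A finite set of [M] that eventually contains any given element. Fixing [pool n] in the factor
    [n] makes the ultrapower fix all images of elements of [M]. *)
Fixpoint pool n : M := if n is n'.+1 then adjoin (pool n') (el n') else W.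

Lemma pool_finite n : finite (pool n).
Proof. by elim: n => // n IH; apply: finite_adjoin. Qed.

Lemma pool_W n x : x ∈ W -> x ∈ pool n.
Proof. by elim: n => // n IH /IH xn; apply/in_adjoin; left. Qed.

Lemma pool_element n k : k < n -> el k ∈ pool n.
Proof.
elim: n => // n IH; rewrite ltnS leq_eqVlt => /orP[/eqP ->|/IH kn].
  by apply/in_adjoin; right.
by apply/in_adjoin; left.
Qed.

Definition start_spec n (r : M * M * M) :=
  [/\ position n r.1.1, injection_in D r.1.1,
      [/\ r.1.2 ∈ S, r.2 ∈ D & ~ r.2 ∈ S], pair_in r.1.1 r.1.2 r.2 &
      forall x : M, x ∈ pool n -> x ∈ D -> pair_in r.1.1 x x].

Lemma start_exists n : exists r, start_spec n r.
Proof.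
have [g [a [b H]]] := position_start n (@pool_finite n).
by exists (g, a, b).
Qed.

Definition start n := sval (cid (start_exists n)).

Lemma startP n : start_spec n (start n).
Proof. by rewrite /start; case: cid. Qed.

Definition reply_spec (right : bool) q g v (r : M * M * M) :=
  [/\ position q r.1.1, legal g r.1.1 r.1.2 r.2 &
      v ∈ A -> (if right then r.2 else r.1.2) = v].

Lemma reply_exists right q g v :
  exists r, position q.+1 g -> reply_spec right q g v r.
Proof.
case: (EM (position q.+1 g)) => [gpos|no]; last by exists (c0, c0, c0).
case: right.
  by have [g' [u [u' H]]] := position_right v gpos; exists (g', u, u').
by have [g' [u [u' H]]] := position_left v gpos; exists (g', u, u').
Qed.

Definition reply right q g v := sval (cid (reply_exists right q g v)).

Lemma replyP right q g v : position q.+1 g ->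
  reply_spec right q g v (reply right q g v).
Proof. by rewrite /reply; case: cid. Qed.

(* In the [n]-th factor the game is played for [n] rounds; [i.1] is the number
   of the round and [i.2] selects a component. *)
Definition op (i : nat * nat) (n : nat) (l : seq M) : M :=
  let r := reply (odd i.1) (n - i.1.+1) (nth c0 l 0) (nth c0 l 1) in
  match i.2 with
  | 0 => r.1.1 | 1 => r.1.2 | 2 => r.2
  | 3 => (start n).1.1 | 4 => (start n).1.2 | _ => (start n).2
  end.

Notation G := (generated c0 M_countable op).
Notation seqn := (sequence c0 M_countable op).

(** Each sequence is proposed twice, [seqn k] in round [2k] on the left and in round [2k + 1] on the
    right. The list [seqn] also contains the states and answers of the play; this is not circular,
    because it enumerates terms built from [op], which is defined before any play. *)
Fixpoint state j : nat -> M :=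
  if j is j'.+1 then fun n => op (j', 0) n [:: state j' n; seqn j'./2 n]
  else fun n => op (0, 3) n [::].

Definition left_tuple j n := op (j, 1) n [:: state j n; seqn j./2 n].
Definition right_tuple j n := op (j, 2) n [:: state j n; seqn j./2 n].
Definition inside n := op (0, 4) n [::].
Definition outside n := op (0, 5) n [::].

Lemma state_position j n : j <= n -> position (n - j) (state j n).
Proof.
elim: j => [|j IH] jn /=; first by rewrite subn0; case: (startP n).
have := IH (ltnW jn); rewrite -(subnSK jn).
by move=> /(replyP (odd j) (seqn j./2 n))[].
Qed.

Lemma state_reply j n : j < n -> reply_spec (odd j) (n - j.+1) (state j n)
  (seqn j./2 n) (state j.+1 n, left_tuple j n, right_tuple j n).
Proof.
move=> jn; have := state_position (ltnW jn); rewrite -(subnSK jn).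
move=> /(replyP (odd j) (seqn j./2 n)).
have -> : (state j.+1 n, left_tuple j n, right_tuple j n) =
    reply (odd j) (n - j.+1) (state j n) (seqn j./2 n).
  by rewrite /left_tuple /right_tuple /= /op /=; case: (reply _ _ _ _) => [[]].
by [].
Qed.

Lemma G_const x : G (fun=> x). Proof. exact: generated_const. Qed.

Lemma G_seqn k : G (seqn k). Proof. exact: generated_sequence. Qed.

Lemma G_state j : G (state j).
Proof.
elim: j => [|j IH]; first exact: generated_op.
by apply: generated_op2 => //; apply: G_seqn.
Qed.

Lemma G_left j : G (left_tuple j).
Proof. by apply: generated_op2; [apply: G_state|apply: G_seqn]. Qed.

Lemma G_right j : G (right_tuple j).
Proof. by apply: generated_op2; [apply: G_state|apply: G_seqn]. Qed.

Lemma G_inside : G inside. Proof. exact: generated_op. Qed.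

Lemma G_outside : G outside. Proof. exact: generated_op. Qed.

Hint Resolve coherent_family G_const G_seqn G_state G_left G_right G_inside
  G_outside : admissible.

Variable U : set_system nat.
Context {U_ultra : UltraFilter U}.
Hypothesis U_cofinite : forall k, U [set n | k < n].

Notation Ext := (ultra c0 U G_const).
Notation cl := (@class M c0 U G G_const).
Notation fam := (@family M c0 U G G_const).
Notation mod := (factor c0 U G_const).
Notation star x := (cl (fun=> x)).

Lemma transfer_to (P : option nat -> Prop) :
  def_pred (@coherent M c0 U G G_const) (fun j _ => P j) ->
  U [set n | P (Some n)] -> P None.
Proof. by move=> dP UP; apply/(transfer U_ultra (@generated_skolem _ _ _ _ _) dP). Qed.

Ltac define_in_factors :=
  prove_def_from (coherent_family c0 U G_const (G_const c0)) 4.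

Notation const x := (fam (fun=> x)).

Lemma star_rels_W (x : Ext) : x ∈ star (rels N) -> x ∈ star W.
Proof.
move: x; apply: (transfer_to (P := fun j => forall x : mod j,
  x ∈ const (rels N) j -> x ∈ const W j)); first by define_in_factors.
by apply: filterE => n; apply: rels_W.
Qed.

Lemma star_funs_W (x : Ext) : x ∈ star (funs N) -> x ∈ star W.
Proof.
move: x; apply: (transfer_to (P := fun j => forall x : mod j,
  x ∈ const (funs N) j -> x ∈ const W j)); first by define_in_factors.
by apply: filterE => n; apply: funs_W.
Qed.

Lemma star_ar_W (c n : Ext) : pair_in (star (ar N)) c n ->
  c ∈ star W /\ n ∈ star W.
Proof.
move: c n; apply: (transfer_to (P := fun j => forall c n : mod j,
  pair_in (const (ar N) j) c n -> c ∈ const W j /\ n ∈ const W j)).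
  by define_in_factors.
by apply: filterE => n; apply: ar_W.
Qed.

Lemma star_tuple_entry (u k x : Ext) : u ∈ star A -> pair_in u k x ->
  k ∈ star W /\ x ∈ star D.
Proof.
move: u k x; apply: (transfer_to (P := fun j => forall u k x : mod j,
  u ∈ const A j -> pair_in u k x -> k ∈ const W j /\ x ∈ const D j)).
  by define_in_factors.
by apply: filterE => n; apply: tuple_entry.
Qed.

Lemma star_tuple_functional (u k x y : Ext) : u ∈ star A -> pair_in u k x ->
  pair_in u k y -> x = y.
Proof.
move: u k x y; apply: (transfer_to (P := fun j => forall u k x y : mod j,
  u ∈ const A j -> pair_in u k x -> pair_in u k y -> x = y)).
  by define_in_factors.
by apply: filterE => n; apply: tuple_functional.
Qed.

Lemma star_entry_tuple (x : Ext) : x ∈ star D ->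
  exists u k : Ext, u ∈ star A /\ pair_in u k x.
Proof.
move: x; apply: (transfer_to (P := fun j => forall x : mod j,
  x ∈ const D j -> exists u k : mod j, u ∈ const A j /\ pair_in u k x)).
  by define_in_factors.
by apply: filterE => n; apply: entry_tuple.
Qed.

Lemma star_rel_tuple (c R t : Ext) : c ∈ star (rels N) ->
  pair_in (star (itp N)) c R -> t ∈ R -> exists n u : Ext,
  [/\ pair_in (star (ar N)) c n, u ∈ star A & restriction u n t].
Proof.
move: c R t; apply: (transfer_to (P := fun j => forall c R t : mod j,
  c ∈ const (rels N) j -> pair_in (const (itp N) j) c R -> t ∈ R ->
  exists n u : mod j, [/\ pair_in (const (ar N) j) c n, u ∈ const A j &
    restriction u n t])); first by define_in_factors.
by apply: filterE => n; apply: rel_tuple.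
Qed.

Lemma star_fun_tuple (c f t y : Ext) : c ∈ star (funs N) ->
  pair_in (star (itp N)) c f -> pair_in f t y -> exists n u : Ext,
  [/\ pair_in (star (ar N)) c n, u ∈ star A, restriction u n t &
      pair_in u (star m) y].
Proof.
move: c f t y; apply: (transfer_to (P := fun j => forall c f t y : mod j,
  c ∈ const (funs N) j -> pair_in (const (itp N) j) c f -> pair_in f t y ->
  exists n u : mod j, [/\ pair_in (const (ar N) j) c n, u ∈ const A j,
    restriction u n t & pair_in u (const m j) y])); first by define_in_factors.
by apply: filterE => n; apply: fun_tuple.
Qed.

Lemma star_start : [/\ injection_in (star D) (cl (state 0)),
  cl inside ∈ star S, cl outside ∈ star D, ~ cl outside ∈ star S &
  pair_in (cl (state 0)) (cl inside) (cl outside)].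
Proof.
apply: (transfer_to (P := fun j => [/\ injection_in (const D j) (fam (state 0) j),
  fam inside j ∈ const S j, fam outside j ∈ const D j,
  ~ fam outside j ∈ const S j &
  pair_in (fam (state 0) j) (fam inside j) (fam outside j)])).
  by define_in_factors.
by apply: filterE => n; have [_ ? [? ? ?] ? _] := startP n; split.
Qed.

Lemma star_start_W (x : Ext) : x ∈ star W -> x ∈ star D ->
  pair_in (cl (state 0)) x x.
Proof.
move: x; apply: (transfer_to (P := fun j => forall x : mod j,
  x ∈ const W j -> x ∈ const D j -> pair_in (fam (state 0) j) x x)).
  by define_in_factors.
by apply: filterE => n x /(pool_W n) xn; have [_ _ _ _] := startP n; apply.
Qed.

Lemma star_start_constant (x : M) : star x ∈ star D ->
  pair_in (cl (state 0)) (star x) (star x).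
Proof.
apply: (transfer_to (P := fun j => const x j ∈ const D j ->
  pair_in (fam (state 0) j) (const x j) (const x j))).
  by define_in_factors.
have [k <-] := element_surj c0 M_countable x.
apply: filterS (U_cofinite k) => n kn xD; have [_ _ _ _] := startP n.
by apply=> //; apply: pool_element.
Qed.

(** Round [j] is legal in every factor with more than [j] rounds, hence in almost all of them. *)
Lemma star_move j : game_move (star D) (star (rels N)) (star (funs N))
  (star (ar N)) (star (itp N)) (star A) (star m) (cl (state j))
  (cl (state j.+1)) (cl (left_tuple j)) (cl (right_tuple j)).
Proof.
apply: (transfer_to (P := fun i => game_move (const D i) (const (rels N) i)
  (const (funs N) i) (const (ar N) i) (const (itp N) i) (const A i) (const m i)
  (fam (state j) i) (fam (state j.+1) i) (fam (left_tuple j) i)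
  (fam (right_tuple j) i))); first by define_in_factors.
by apply: filterS (U_cofinite j) => n /state_reply[].
Qed.

Lemma star_answer j : cl (seqn j./2) ∈ star A ->
  (if odd j then cl (right_tuple j) else cl (left_tuple j)) = cl (seqn j./2).
Proof.
have H : U [set n | seqn j./2 n ∈ A ->
    (if odd j then right_tuple j n else left_tuple j n) = seqn j./2 n].
  by apply: filterS (U_cofinite j) => n /state_reply[].
case: (odd j) H => H.
  apply: (transfer_to (P := fun i => fam (seqn j./2) i ∈ const A i ->
    fam (right_tuple j) i = fam (seqn j./2) i)) => //; by define_in_factors.
apply: (transfer_to (P := fun i => fam (seqn j./2) i ∈ const A i ->
  fam (left_tuple j) i = fam (seqn j./2) i)) => //; by define_in_factors.
Qed.

Lemma ext_sequence (x : Ext) : exists k, x = cl (seqn k).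
Proof.
have [g [Gg ->]] := class_surj x.
by have [k ->] := sequence_surj Gg; exists k.
Qed.

(** * The permutation obtained from the play *)

Definition matches (x y : Ext) : Prop := exists j, pair_in (cl (state j)) x y.

Lemma state_mono i j : i <= j -> extends (cl (state i)) (cl (state j)).
Proof.
elim: j => [|j IH]; first by rewrite leqn0 => /eqP ->.
rewrite leq_eqVlt => /orP[/eqP -> //|/IH ij] x y /ij.
by have [[H _ _ _] _ _ _] := star_move j; apply: H.
Qed.

Lemma state_injection j : injection_in (star D) (cl (state j)).
Proof.
case: j => [|j]; first by case: star_start.
by have [[]] := star_move j.
Qed.

Lemma matches_dom x y : matches x y -> x ∈ star D /\ y ∈ star D.
Proof. by move=> [j xy]; have [] := @state_injection j _ _ xy. Qed.

Lemma matches_inj x y x' y' : matches x y -> matches x' y' -> x = x' <-> y = y'.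
Proof.
move=> [i xy] [j xy']; have /state_injection[_ _ inj] := state_mono (leq_maxl i j) xy.
exact: inj (state_mono (leq_maxr i j) xy').
Qed.

Lemma tuple_left u : u ∈ star A -> exists j, u = cl (left_tuple j).
Proof.
move=> uA; have [k uE] := ext_sequence u; exists k.*2.
by have := @star_answer k.*2; rewrite odd_double doubleK -uE => ->.
Qed.

Lemma tuple_right u : u ∈ star A -> exists j, u = cl (right_tuple j).
Proof.
move=> uA; have [k uE] := ext_sequence u; exists k.*2.+1.
have := @star_answer k.*2.+1.
by rewrite /= odd_double /= uphalf_double -uE => ->.
Qed.

(** Every element is an entry of some tuple, and every tuple is proposed on the left in some
    round. *)
Lemma matches_total x : x ∈ star D -> exists y, matches x y.
Proof.
move=> /star_entry_tuple[u [k [/tuple_left[j ->] kx]]].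
have [_ [H _] _ _] := star_move j; have [y [_ xy]] := H _ _ kx.
by exists y, j.+1.
Qed.

Lemma matches_onto y : y ∈ star D -> exists x, matches x y.
Proof.
move=> /star_entry_tuple[u [k [/tuple_right[j ->] kx]]].
have [_ [_ H] _ _] := star_move j; have [x [_ xy]] := H _ _ kx.
by exists x, j.+1.
Qed.

Definition swap (x : Ext) : Ext :=
  if pselect (exists y, matches x y) is left e then sval (cid e) else x.

Lemma swap_matches x y : matches x y -> swap x = y.
Proof.
move=> xy; rewrite /swap; case: pselect => [e|[]]; last by exists y.
by case: cid => z /= xz; apply/(matches_inj xz xy).
Qed.

Lemma swap_dom x : x ∈ star D -> matches x (swap x).
Proof. by move=> /matches_total[y xy]; rewrite (swap_matches xy). Qed.

Lemma swap_out x : ~ x ∈ star D -> swap x = x.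
Proof.
move=> xD; rewrite /swap; case: pselect => // e.
by case: xD; have [y /matches_dom[]] := e.
Qed.

Lemma swap_inj : injective swap.
Proof.
move=> x y; case: (EM (x ∈ star D)) => xD; case: (EM (y ∈ star D)) => yD.
- by move=> E; apply/(matches_inj (swap_dom xD) (swap_dom yD)).
- by rewrite (swap_out yD) => E; case: yD; rewrite -E; case: (matches_dom (swap_dom xD)).
- by rewrite (swap_out xD) => E; case: xD; rewrite E; case: (matches_dom (swap_dom yD)).
- by rewrite !swap_out.
Qed.

(** This matters when symbols or positions of entries are themselves elements of the domain: the
    renaming must not disturb the language or the graphs of tuples. *)
Lemma swap_W x : x ∈ star W -> swap x = x.
Proof.
move=> xW; case: (EM (x ∈ star D)) => [xD|]; last exact: swap_out.
by apply: swap_matches; exists 0; apply: star_start_W.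
Qed.

Lemma swap_star (x : M) : swap (star x) = star x.
Proof.
case: (EM (star x ∈ star D)) => [xD|]; last exact: swap_out.
by apply: swap_matches; exists 0; apply: star_start_constant.
Qed.

Lemma star_elementary : elementary (fun x : M => star x : Ext).
Proof.
exact: (@diagonal_elementary M c0 U U_ultra G G_const (@generated_skolem M c0 _ _ op)).
Qed.

Definition extension1 : elementary_extension (fun x : M => star x : Ext) :=
  @ElemExt M Ext _ Ext id (fun _ _ => id) _ (fun=> erefl) star_elementary.

(** The model is that of [extension1]; only its placement in the common set changes. [swap_star]
    keeps the copy of [M] where it was. *)
Definition extension2 : elementary_extension (fun x : M => star x : Ext) :=
  @ElemExt M Ext _ Ext swap swap_inj _ swap_star star_elementary.

(* [u] and [u'] are the tuples matched in round [j]. *)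
Lemma graph_matches j n t t' :
  restriction (cl (left_tuple j)) n t -> restriction (cl (right_tuple j)) n t' ->
  graph (M' := extension1) t' = graph (M' := extension2) t.
Proof.
move=> ut ut'; have [[_ _ uA u'A] [H H'] _ _] := star_move j.
apply/seteqP; split=> q [k [x [kx ->]]] /=.
  have [kn u'kx] := (ut' k x).1 kx; have [y [uky yx]] := H' _ _ u'kx.
  have [kW _] := star_tuple_entry u'A u'kx.
  exists k, y; split; first exact/ut.
  by rewrite /= (swap_W kW) (swap_matches (x := y) (y := x)) //; exists j.+1.
have [kn ukx] := (ut k x).1 kx; have [y [u'ky xy]] := H _ _ ukx.
have [kW _] := star_tuple_entry uA ukx.
exists k, y; split; first exact/ut'.
by rewrite /= (swap_W kW) (swap_matches (x := x) (y := y)) //; exists j.+1.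
Qed.

Lemma elements_W (x : M) : (forall y : Ext, y ∈ star x -> y ∈ star W) ->
  elements extension1 x = elements extension2 x.
Proof.
move=> xW; apply/seteqP; split=> _ [y /= yx <-].
  by exists y => //=; rewrite swap_W //; apply: xW.
by exists y => //=; rewrite swap_W //; apply: xW.
Qed.

Lemma elements_dom : elements extension1 D = elements extension2 D.
Proof.
apply/seteqP; split=> _ [y /= yD <-].
  have [x xy] := matches_onto yD; exists x; last exact: swap_matches.
  by case: (matches_dom xy).
by exists (swap y) => //; case: (matches_dom (swap_dom yD)).
Qed.

(** A tuple from a relation or a function graph is extended to an element of [A], which is proposed
    in some round; restricting the answer gives the corresponding tuple on the other side. As [swap]
    leads from left to right, tuples of [extension1] are proposed on the right and those of
    [extension2] on the left. *)
Lemma interpretation_eq :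
  interpretation extension1 N = interpretation extension2 N.
Proof.
rewrite /interpretation elements_dom (elements_W star_rels_W) (elements_W star_funs_W).
congr ExtStructure.
- apply/seteqP; split=> _ [c [n [cn ->]]] /=; have [cW nW] := star_ar_W cn;
    by exists c, n; split=> //=; rewrite !swap_W.
- apply/funext => s; apply/seteqP; split=> _ [c [R [t [/= cs cr cR tR ->]]]].
    have [n [u [cn /tuple_right[j uE] ut]]] := star_rel_tuple cr cR tR.
    rewrite uE in ut; have [_ _ [_ pres] _] := star_move j.
    have [t' [t'R ut']] := pres _ _ _ _ cr cn cR tR ut.
    exists c, R, t'; split=> //=; last exact: graph_matches ut' ut.
    by rewrite swap_W //; apply: star_rels_W.
  have [n [u [cn /tuple_left[j uE] ut]]] := star_rel_tuple cr cR tR.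
  rewrite uE in ut; have [_ _ [pres _] _] := star_move j.
  have [t' [t'R ut']] := pres _ _ _ _ cr cn cR tR ut.
  exists c, R, t'; split=> //=; last exact/esym/(graph_matches ut ut').
  by rewrite -cs swap_W //; apply: star_rels_W.
- apply/funext => s; apply/seteqP; split=> _ [c [f [t [y [/= cs cf cff ty ->]]]]].
    have [n [u [cn /tuple_right[j uE] ut my]]] := star_fun_tuple cf cff ty.
    rewrite uE in ut my; have [[_ _ uA _] [_ H] _ [_ pres]] := star_move j.
    have [t' [y' [ty' ut' my']]] := pres _ _ _ _ _ cf cn cff ty ut my.
    have [z [mz zy]] := H _ _ my.
    (* A tuple has one entry at [m], so the value [y'] obtained from preservation is the one matched
       with [y]. *)
    rewrite -(star_tuple_functional uA my' mz) in zy.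
    exists c, f, t', y'; split=> //=.
      by rewrite swap_W //; apply: star_funs_W.
    rewrite (graph_matches ut' ut) (swap_matches (x := y') (y := y)) //.
    by exists j.+1.
  have [n [u [cn /tuple_left[j uE] ut my]]] := star_fun_tuple cf cff ty.
  rewrite uE in ut my; have [[_ _ _ u'A] [H _] _ [pres _]] := star_move j.
  have [t' [y' [ty' ut' my']]] := pres _ _ _ _ _ cf cn cff ty ut my.
  have [z [mz yz]] := H _ _ my.
  rewrite -(star_tuple_functional u'A my' mz) in yz.
  exists c, f, t', y'; split=> //=.
    by rewrite -cs swap_W //; apply: star_funs_W.
  rewrite (graph_matches ut ut') (swap_matches (x := y) (y := y')) //.
  by exists j.+1.
Qed.

Lemma elements_neq : elements extension1 S <> elements extension2 S.
Proof.
have [_ iS _ oS io] := star_start; move=> E.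
have : elements extension2 S (cl outside).
  (* The pair of [inside] and [outside] is already present in the initial state. *)
  exists (cl inside) => //=; apply: swap_matches; by exists 0.
by rewrite -E => -[y /= yS yE]; apply: oS; rewrite -yE.
Qed.

Lemma two_extensions : exists (V : Type) (i : M -> V)
    (M1 M2 : elementary_extension i),
  interpretation M1 N = interpretation M2 N /\ elements M1 S <> elements M2 S.
Proof.
exists Ext, (fun x => star x), extension1, extension2.
by split; [apply: interpretation_eq|apply: elements_neq].
Qed.

End TwoExtensions.

Unset Implicit Arguments.

Theorem theorem5 (M : model) (N : structure M) (S : M)
  (M_countable : countable [set: M])
  (M_ZFC : ZFC M)
  (N_finite_language : finite_language N)
  (S_subset : subset_in S (dom N))
  (S_undefinable : ~ definable N S) :
  exists (U : Type) (i : M -> U) (M1 M2 : elementary_extension i),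
    interpretation M1 N = interpretation M2 N /\
    elements M1 S <> elements M2 S.
Proof.
pose M' := ZFCModel M_ZFC.
have [W [A [m [position H]]]] :=
  @game_exists M' N S N_finite_language S_subset S_undefinable.
have [[W_fin rels_W funs_W ar_W] [? ? ? ? ?] start left right] := H.
have [F [F_ultra F_cofinite]] := ultraFilterLemma eventually_filter.
have cofinite k : F [set n | k < n] by apply: F_cofinite; exists k.+1.
by apply: (two_extensions (M := M') M_countable W_fin rels_W funs_W ar_W) cofinite;
  eassumption.
Qed.
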